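(* Let $\mathfrak n=\mathfrak n_1\oplus\mathfrak n_2$ be an $8$-dimensional real vector space, where $\mathfrak n_1$ has basis $X_1,\dots,X_4$ and $\mathfrak n_2$ has basis $Z_1,\dots,Z_4$. Let $J_1,J_2,J_3$ be the endomorphisms preserving $\mathfrak n_1$ and $\mathfrak n_2$ and acting on each of them, with respect to the given basis (written $e_1,\dots,e_4$), by $$J_1e_1=e_2,\ J_1e_2=-e_1,\ J_1e_3=e_4,\ J_1e_4=-e_3;\quad J_2e_1=e_3,\ J_2e_2=-e_4,\ J_2e_3=-e_1,\ J_2e_4=e_2;\quad J_3=J_1J_2,$$ and let $\langle\cdot,\cdot\rangle$ be the inner product making $\{X_i\}\cup\{Z_i\}$ orthonormal. For $0\le r\le s\le t$ with $r^2+s^2+t^2=1$ let $\mu_{rst}$ be the $2$-step nilpotent Lie bracket whose only non-zero brackets, up to skew-symmetry, are $$\mu_{rst}(X_1,X_2)=rZ_2,\quad \mu_{rst}(X_3,X_4)=-rZ_2,\quad \mu_{rst}(X_1,X_3)=sZ_3,\quad \mu_{rst}(X_2,X_4)=sZ_3,$$ $$\mu_{rst}(X_1,X_4)=tZ_4,\quad \mu_{rst}(X_2,X_3)=-tZ_4 .$$ Then: (i) for each such $(r,s,t)$, $\{J_1,J_2,J_3\}$ is an abelian hypercomplex structure on $N_{\mu_{rst}}$ and $\langle\cdot,\cdot\rangle$ is a minimal compatible metric for it; (ii) the Riemannian manifolds $(N_{\mu_{rst}},\langle\cdot,\cdot\rangle)$ are pairwise non-isometric, and the hypercomplex nilpotent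 Lie groups $(N_{\mu_{rst}},\{J_1,J_2,J_3\})$ are pairwise non-isomorphic (for distinct triples $(r,s,t)$); (iii) $(\mathfrak n,\mu_{rst})$ is isomorphic to $\mathfrak g_3$ if $r>0$, to $\mathfrak g_2$ if $r=0<s$, and to $\mathfrak g_1$ if $r=s=0$, $t=1$.
   Context: $\mathfrak g_1,\mathfrak g_2,\mathfrak g_3$ denote the $8$-dimensional real Lie algebras obtained as the direct sum of an abelian Lie algebra (of dimension $3$, $2$, $1$ respectively) with, respectively, the $5$-dimensional real Heisenberg Lie algebra, the $6$-dimensional (real dimension) complex Heisenberg Lie algebra, and the $7$-dimensional quaternionic Heisenberg Lie algebra (that is, $\mathbb H\oplus\operatorname{Im}\mathbb H$ with center $\operatorname{Im}\mathbb H$ and $[x,y]=\operatorname{Im}(\bar x y)$ for $x,y\in\mathbb H$). For a nilpotent Lie bracket $\mu$ on $\mathfrak n$, $N_\mu$ denotes the simply connected nilpotent Lie group with Lie algebra $(\mathfrak n,\mu)$; tensors on $\mathfrak n$ define left invariant structures on $N_\mu$. A triple $\{J_1,J_2,J_3\}$ of endomorphisms with $J_i^2=-I$, $J_1J_2=J_3=-J_2J_1$ is a hypercomplex structure on $N_\mu$ if each $J=J_i$ satisfies $\mu(JX,JY)=\mu(X,Y)+J\mu(JX,Y)+J\mu(X,JY)$ for all $X,Y\in\mathfrak n$; it is abelian if $\mu(J_iX,J_iY)=\mu(X,Y)$ for all $X,Y$ and $i=1,2,3$. Two hypercomplex nilpotent Lie groups are isomorphic if there is a Lie algebra isomorphism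 $\varphi$ between their Lie algebras with $\varphi J_i'\varphi^{-1}=J_i$, $i=1,2,3$. An inner product is compatible if $\langle J_iX,J_iY\rangle=\langle X,Y\rangle$ for all $X,Y$ and $i=1,2,3$. With $\mathrm{Ric}$ the Ricci operator of $(N_\mu,\langle\cdot,\cdot\rangle)$, the invariant Ricci operator is $\mathrm{Ric}^\gamma=\frac14(\mathrm{Ric}-J_1\mathrm{Ric}J_1-J_2\mathrm{Ric}J_2-J_3\mathrm{Ric}J_3)$. A compatible metric is called minimal if it minimizes $\operatorname{tr}(\mathrm{Ric}^\gamma)^2$ among all left invariant metrics compatible with $(N_\mu,\{J_1,J_2,J_3\})$ having the same scalar curvature. *)

(* Defs.v *)
(* The real numbers are an arbitrary realType. *)
From HB Require Import structures.
From mathcomp Require Import all_boot all_order all_algebra.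
From mathcomp Require Import all_classical all_reals all_analysis.
From mathcomp Require Import complex.
From mathcomp Require Import ring.

Set Implicit Arguments.
Unset Strict Implicit.
Unset Printing Implicit Defensive.

Import Order.TTheory GRing.Theory Num.Theory.
Import numFieldNormedType.Exports.

Local Open Scope classical_set_scope.
Local Open Scope ring_scope.

Section LieBrackets.
Variable R : realType.

Definition is_lie_bracket (V : lmodType R) (mu : V -> V -> V) : Prop :=
  [/\ forall (a : R) x x' y, mu (a *: x + x') y = a *: mu x y + mu x' y,
      forall (a : R) x y y', mu x (a *: y + y') = a *: mu x y + mu x y',
      forall x, mu x x = 0
    & forall x y z, mu x (mu y z) + mu y (mu z x) + mu z (mu x y) = 0].

(* nilpotency class at most two *)
Definition two_step (V : lmodType R) (mu : V -> V -> V) : Prop :=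
  forall x y z, mu (mu x y) z = 0.

Definition lie_iso (V W : lmodType R) (mu : V -> V -> V) (nu : W -> W -> W)
    (phi : {linear V -> W}) : Prop :=
  bijective phi /\ forall x y, phi (mu x y) = nu (phi x) (phi y).

Definition lie_isomorphic (V W : lmodType R)
    (mu : V -> V -> V) (nu : W -> W -> W) : Prop :=
  exists phi : {linear V -> W}, lie_iso mu nu phi.

Definition abelian_bracket (V : lmodType R) (x y : V) : V := 0.

Definition sum_bracket (V W : lmodType R) (mu : V -> V -> V) (nu : W -> W -> W)
    (p q : V * W) : V * W := (mu p.1 q.1, nu p.2 q.2).

End LieBrackets.

Section Heisenberg.
Variable R : realType.

(* The Heisenberg algebra K^n + K^n + K over K, regarded as a real Lie algebra:
   [(x, y, z), (x', y', z')] = (0, 0, sum_i (x_i y'_i - x'_i y_i)). *)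
Definition heis_type (K : lalgType R) (n : nat) : lmodType R :=
  ({ffun 'I_n -> K} * {ffun 'I_n -> K} * K)%type.

Definition heis_bracket (K : lalgType R) (n : nat)
    (p q : heis_type K n) : heis_type K n :=
  (0, 0, \sum_(i < n) (p.1.1 i * q.1.2 i - q.1.1 i * p.1.2 i)).

(* (a, b, c, d) stands for a + b i + c j + d k, and (b, c, d) for
   b i + c j + d k in Im H. *)
Definition quat : lmodType R := (R^o * R^o * R^o * R^o)%type.
Definition imquat : lmodType R := (R^o * R^o * R^o)%type.

Definition qconj (x : quat) : quat :=
  let: (a, b, c, d) := x in (a, - b, - c, - d).

Definition qmul (x y : quat) : quat :=
  let: (a, b, c, d) := x in
  let: (a', b', c', d') := y in
  (a * a' - b * b' - c * c' - d * d',
   a * b' + b * a' + c * d' - d * c',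
   a * c' - b * d' + c * a' + d * b',
   a * d' + b * c' - c * b' + d * a').

Definition qIm (x : quat) : imquat := let: (a, b, c, d) := x in (b, c, d).

Definition qheis_type : lmodType R := (quat * imquat)%type.

Definition qheis_bracket (p q : qheis_type) : qheis_type :=
  (0, qIm (qmul (qconj p.1) q.1)).

Definition g1_type : lmodType R := ('rV[R]_3 * heis_type R^o 2)%type.
Definition g1_bracket : g1_type -> g1_type -> g1_type :=
  sum_bracket (@abelian_bracket R 'rV[R]_3) (@heis_bracket R^o 2).

(* Rcomplex R is the field of complex numbers as a real algebra. *)
Definition g2_type : lmodType R :=
  ('rV[R]_2 * heis_type (Rcomplex R) 1)%type.
Definition g2_bracket : g2_type -> g2_type -> g2_type :=
  sum_bracket (@abelian_bracket R 'rV[R]_2)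
    (@heis_bracket (Rcomplex R) 1).

Definition g3_type : lmodType R := ('rV[R]_1 * qheis_type)%type.
Definition g3_bracket : g3_type -> g3_type -> g3_type :=
  sum_bracket (@abelian_bracket R 'rV[R]_1) qheis_bracket.

End Heisenberg.

(* Left invariant geometry of N_mu, on the Lie algebra R^(n+1). Endomorphisms
   are matrices acting on column vectors, inner products are Gram matrices. *)
Section LeftInvariant.
Variables (R : realType) (n : nat).
Local Notation V := 'cV[R]_n.+1.
Local Notation M := 'M[R]_n.+1.

Definition ip (G : M) (x y : V) : R := (x^T *m G *m y) 0 0.

Definition inner_product (G : M) : Prop :=
  G^T = G /\ forall x : V, x != 0 -> 0 < ip G x x.

Lemma ip_sym (G : M) (x y : V) : G^T = G -> ip G x y = ip G y x.
Proof.
move=> Gs; rewrite /ip -[in LHS](trmxK (x^T *m G *m y)) mxE.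
by rewrite !trmx_mul trmxK Gs mulmxA.
Qed.

Lemma inner_product_unit (G : M) : inner_product G -> G \in unitmx.
Proof.
move=> [Gs Gp]; rewrite -row_free_unit -kermx_eq0; apply/negPn/negP => K.
have /rowV0Pn[v vK v0] := K.
have vG : v *m G = 0 by apply/eqP; rewrite -sub_kermx.
have := Gp v^T; rewrite -(inj_eq (@trmx_inj _ _ _)) trmxK trmx0 => /(_ v0).
by rewrite /ip trmxK vG mul0mx mxE ltxx.
Qed.

Lemma ipDl (G : M) (x y z : V) : ip G (x + y) z = ip G x z + ip G y z.
Proof. by rewrite /ip linearD /= !mulmxDl mxE. Qed.

Lemma ipDr (G : M) (x y z : V) : ip G z (x + y) = ip G z x + ip G z y.
Proof. by rewrite /ip !mulmxDr mxE. Qed.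

Lemma ipZl (G : M) (a : R) (x z : V) : ip G (a *: x) z = a * ip G x z.
Proof. by rewrite /ip linearZ /= -!scalemxAl mxE. Qed.

Lemma ipZr (G : M) (a : R) (x z : V) : ip G z (a *: x) = a * ip G z x.
Proof. by rewrite /ip -!scalemxAr mxE. Qed.

Definition basis_vec (k : 'I_n.+1) : V := delta_mx k 0.

(* Levi-Civita connection on left invariant fields, by the Koszul formula
     2 <nabla_x y, z> = <[x, y], z> - <[y, z], x> + <[z, x], y>;
   invmx G turns the covector z |-> <nabla_x y, z> into a vector. *)
Definition nabla (mu : V -> V -> V) (G : M) (x y : V) : V :=
  invmx G *m \col_k (2^-1 * (ip G (mu x y) (basis_vec k)
                             - ip G (mu y (basis_vec k)) x
                             + ip G (mu (basis_vec k) x) y)).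

Lemma nablaP (mu : V -> V -> V) (G : M) (x y z : V) :
  is_lie_bracket mu -> inner_product G ->
  2 * ip G (nabla mu G x y) z
  = ip G (mu x y) z - ip G (mu y z) x + ip G (mu z x) y.
Proof.
move=> [linl linr alt _] Gi; have [Gs _] := Gi.
have Gu := inner_product_unit Gi.
pose K z := ip G (mu x y) z - ip G (mu y z) x + ip G (mu z x) y.
have mul0 a : mu 0 a = 0.
  by have := linl (-1) 0 0 a; rewrite scaler0 addr0 scaleN1r addNr.
have mur0 a : mu a 0 = 0.
  by have := linr (-1) a 0 0; rewrite scaler0 addr0 scaleN1r addNr.
have KL a u v : K (a *: u + v) = a * K u + K v.
  by rewrite /K linl linr !(ipDl, ipDr, ipZl, ipZr); ring.
have K0 : K 0 = 0.
  have ip0 a : ip G a 0 = 0 by rewrite /ip mulmx0 mxE.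
  have ip0' a : ip G 0 a = 0 by rewrite (ip_sym _ _ Gs).
  by rewrite /K mul0 mur0 ip0 !ip0' subrr addr0.
have Ksum (F : 'I_n.+1 -> R) :
    K (\sum_k F k *: basis_vec k) = \sum_k F k * K (basis_vec k).
  by elim/big_rec2: _ => [//|k u v _ <-]; rewrite KL.
have zE : z = \sum_k z k 0 *: basis_vec k.
  apply/matrixP => i j; rewrite summxE (bigD1 i) //= big1 ?addr0.
    by rewrite !mxE !ord1 !eqxx mulr1.
  by move=> k /negbTE ki; rewrite !mxE eq_sym ki mulr0.
rewrite -[RHS]/(K z) (ip_sym _ _ Gs) /ip /nabla -!mulmxA (mulKVmx Gu).
rewrite {2}zE Ksum mxE big_distrr /=; apply: eq_bigr => k _.
by rewrite !mxE -/(K _); field.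
Qed.

Definition curvature (mu : V -> V -> V) (G : M) (x y z : V) : V :=
  nabla mu G x (nabla mu G y z) - nabla mu G y (nabla mu G x z)
  - nabla mu G (mu x y) z.

(* ric(y, z) is the trace of x |-> curvature x y z. *)
Definition ricci_tensor (mu : V -> V -> V) (G : M) (y z : V) : R :=
  \sum_k curvature mu G (basis_vec k) y z k 0.

(* <Ric x, y> = ric(x, y) *)
Definition ricci_op (mu : V -> V -> V) (G : M) : M :=
  invmx G *m \matrix_(i, j) ricci_tensor mu G (basis_vec i) (basis_vec j).

Definition scalar_curvature (mu : V -> V -> V) (G : M) : R :=
  \tr (ricci_op mu G).

Definition integrable (mu : V -> V -> V) (J : M) : Prop :=
  forall x y : V,
    mu (J *m x) (J *m y) = mu x y + J *m mu (J *m x) y + J *m mu x (J *m y).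

Definition hypercomplex (mu : V -> V -> V) (J1 J2 J3 : M) : Prop :=
  [/\ [/\ J1 *m J1 = - 1%:M, J2 *m J2 = - 1%:M & J3 *m J3 = - 1%:M],
      J1 *m J2 = J3 /\ J3 = - (J2 *m J1)
    & [/\ integrable mu J1, integrable mu J2 & integrable mu J3]].

Definition abelian_cplx (mu : V -> V -> V) (J : M) : Prop :=
  forall x y : V, mu (J *m x) (J *m y) = mu x y.

Definition abelian_hypercomplex (mu : V -> V -> V) (J1 J2 J3 : M) : Prop :=
  hypercomplex mu J1 J2 J3 /\
  [/\ abelian_cplx mu J1, abelian_cplx mu J2 & abelian_cplx mu J3].

Definition hypercomplex_isomorphic
    (mu : V -> V -> V) (J1 J2 J3 : M) (mu' : V -> V -> V) (J1' J2' J3' : M) :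
    Prop :=
  exists phi : {linear V -> V},
    lie_iso mu' mu phi /\
    [/\ forall x, phi (J1' *m x) = J1 *m phi x,
        forall x, phi (J2' *m x) = J2 *m phi x
      & forall x, phi (J3' *m x) = J3 *m phi x].

Definition hermitian_for (J G : M) : Prop :=
  forall x y : V, ip G (J *m x) (J *m y) = ip G x y.

Definition compatible_metric (J1 J2 J3 G : M) : Prop :=
  inner_product G /\
  [/\ hermitian_for J1 G, hermitian_for J2 G & hermitian_for J3 G].

Definition invariant_ricci (mu : V -> V -> V) (J1 J2 J3 G : M) : M :=
  let Ric := ricci_op mu G in
  4^-1 *: (Ric - J1 *m Ric *m J1 - J2 *m Ric *m J2 - J3 *m Ric *m J3).

Definition tr_sq (A : M) : R := \tr (A *m A).

Definition minimal_metric (mu : V -> V -> V) (J1 J2 J3 G : M) : Prop :=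
  compatible_metric J1 J2 J3 G /\
  forall G' : M, compatible_metric J1 J2 J3 G' ->
    scalar_curvature mu G' = scalar_curvature mu G ->
    tr_sq (invariant_ricci mu J1 J2 J3 G)
      <= tr_sq (invariant_ricci mu J1 J2 J3 G').

(* For a two-step nilpotent bracket, the simply connected group N_mu is the
   vector space itself with the Baker-Campbell-Hausdorff product, in which the
   inverse of p is - p. *)
Definition bch_mul (mu : V -> V -> V) (p q : V) : V :=
  p + q + 2^-1 *: mu p q.

Lemma bch_mulA (mu : V -> V -> V) :
  is_lie_bracket mu -> two_step mu -> associative (bch_mul mu).
Proof.
move=> [linl linr alt _] ts x y z.
have addl a b c : mu (a + b) c = mu a c + mu b c.
  by have := linl 1 a b c; rewrite !scale1r.
have addr' a b c : mu a (b + c) = mu a b + mu a c.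
  by have := linr 1 a b c; rewrite !scale1r.
have anti a b : mu a b = - mu b a.
  by apply/eqP; rewrite -addr_eq0; have := alt (a + b);
    rewrite addl !addr' !alt add0r addr0 => ->.
have mu0 a : mu a 0 = 0 by have := linr 1 a 0 0; rewrite !scale1r addr0;
  move/eqP; rewrite -subr_eq0 opprD addNKr oppr_eq0 => /eqP.
have scl k a b c : mu (k *: mu a b) c = 0.
  by rewrite -[k *: _]addr0 linl ts scaler0 add0r anti mu0 oppr0.
have scr k a b c : mu c (k *: mu a b) = 0 by rewrite anti scl oppr0.
rewrite /bch_mul !addl !addr' scl scr !addr0.
by rewrite !scalerDr; apply/matrixP => i j; rewrite !mxE; ring.
Qed.

(* A Riemannian metric on the manifold R^(n+1) assigns to a point p a bilinear
   form on the tangent space at p; the left invariant one with value <.,.> at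
   the identity is the pullback of <.,.> by the left translation by p^-1. *)
Definition left_invariant_metric (mu : V -> V -> V) (G : M) (p u v : V) : R :=
  ip G ('d (bch_mul mu (- p)) p u) ('d (bch_mul mu (- p)) p v).

(* C^infinity: all iterated directional derivatives are differentiable. *)
Definition smooth (f : V -> V) : Prop :=
  forall (vs : seq V) (p : V),
    differentiable (foldr (fun v (g : V -> V) => 'D_v g) f vs) p.

Definition isometric (g g' : V -> V -> V -> R) : Prop :=
  exists f h : V -> V,
    [/\ smooth f, smooth h, cancel f h, cancel h f
      & forall p u v : V, g' (f p) ('d f p u) ('d f p v) = g p u v].

End LeftInvariant.

Section Example.
Variable R : realType.
Local Notation V := 'cV[R]_8.

(* X_k and Z_k for 1 <= k <= 4 *)
Definition X (k : nat) : V := delta_mx (inord k.-1) 0.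
Definition Z (k : nat) : V := delta_mx (inord (k + 3)) 0.

(* x_i y_j - x_j y_i, in the coordinates along X_1, .., X_4 *)
Definition minor (i j : nat) (x y : V) : R :=
  x (inord i.-1) 0 * y (inord j.-1) 0 - x (inord j.-1) 0 * y (inord i.-1) 0.

Definition mu_rst (r s t : R) (x y : V) : V :=
    (r * (minor 1 2 x y - minor 3 4 x y)) *: Z 2
  + (s * (minor 1 3 x y + minor 2 4 x y)) *: Z 3
  + (t * (minor 1 4 x y - minor 2 3 x y)) *: Z 4.

Lemma minor_linl (i j : nat) (a : R) (x x' y : V) :
  minor i j (a *: x + x') y = a * minor i j x y + minor i j x' y.
Proof.
rewrite /minor !mxE; move: (inord _) (inord _) => k l.
by move: (x k 0) (x l 0) (x' k 0) (x' l 0) (y k 0) (y l 0) => *; ring.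
Qed.

Lemma minor_anti (i j : nat) (x y : V) : minor i j x y = - minor i j y x.
Proof. by rewrite /minor opprB [x _ _ * _]mulrC [x _ _ * _]mulrC. Qed.

Lemma minor_alt (i j : nat) (x : V) : minor i j x x = 0.
Proof. by rewrite /minor [X in X - _]mulrC subrr. Qed.

Lemma mu_rst_lie_two_step (r s t : R) :
  is_lie_bracket (mu_rst r s t) /\ two_step (mu_rst r s t).
Proof.
have D k i : (k < 4)%N -> (0 < i <= 4)%N ->
    (inord k == inord (i + 3) :> 'I_8) = false.
  move=> k4 /andP[i0 i4]; apply/negbTE/eqP => /(congr1 (@nat_of_ord 8)).
  rewrite !inordK ?(leq_trans k4) //; last by rewrite -(leq_add2r 3) in i4.
  by apply/eqP; rewrite ltn_eqF // (leq_trans k4) // (leq_add2r 3 1).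
have coord0 x y k : (k < 4)%N -> mu_rst r s t x y (inord k) 0 = 0.
  by move=> k4; rewrite !mxE !D // !mulr0 !addr0.
have minor0 i j x y z : (i.-1 < 4)%N -> (j.-1 < 4)%N ->
    minor i j (mu_rst r s t x y) z = 0.
  by move=> i4 j4; rewrite /minor !coord0 // !mul0r subrr.
have ts : two_step (mu_rst r s t).
  move=> x y z; rewrite [LHS]/mu_rst !minor0 //.
  by rewrite subrr addr0 !mulr0 !scale0r !addr0.
have anti x y : mu_rst r s t x y = - mu_rst r s t y x.
  rewrite /mu_rst ![minor _ _ x y]minor_anti; move: (Z 2) (Z 3) (Z 4) => u v w.
  move: (minor 1 2 y x) (minor 3 4 y x) (minor 1 3 y x) (minor 2 4 y x)
    (minor 1 4 y x) (minor 2 3 y x) => *.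
  by apply/matrixP => i j; rewrite !mxE;
    move: (u i j) (v i j) (w i j) => *; ring.
have linl a x x' y :
    mu_rst r s t (a *: x + x') y = a *: mu_rst r s t x y + mu_rst r s t x' y.
  rewrite /mu_rst !minor_linl; move: (Z 2) (Z 3) (Z 4) => u v w.
  move: (minor 1 2 x y) (minor 3 4 x y) (minor 1 3 x y) (minor 2 4 x y)
    (minor 1 4 x y) (minor 2 3 x y) (minor 1 2 x' y) (minor 3 4 x' y)
    (minor 1 3 x' y) (minor 2 4 x' y) (minor 1 4 x' y) (minor 2 3 x' y) => *.
  by apply/matrixP => i j; rewrite !mxE;
    move: (u i j) (v i j) (w i j) => *; ring.
split=> //; split=> // [a x y y' | x | x y z].
- by rewrite anti linl opprD -scalerN -!anti.
- by rewrite /mu_rst !minor_alt subrr addr0 !mulr0 !scale0r !addr0.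
- by rewrite ![mu_rst r s t _ (mu_rst r s t _ _)]anti !ts !oppr0 !addr0.
Qed.

(* For 1 <= i, j <= 4, e_j |-> e_i on both n_1 and n_2, and e_k |-> 0 for the
   other k. *)
Definition E (i j : nat) : 'M[R]_8 :=
  delta_mx (inord i.-1) (inord j.-1) + delta_mx (inord (i + 3)) (inord (j + 3)).

Definition J1 : 'M[R]_8 := E 2 1 - E 1 2 + E 4 3 - E 3 4.
Definition J2 : 'M[R]_8 := E 3 1 - E 4 2 - E 1 3 + E 2 4.
Definition J3 : 'M[R]_8 := J1 *m J2.

Definition admissible (r s t : R) : Prop :=
  [/\ 0 <= r, r <= s, s <= t & r ^+ 2 + s ^+ 2 + t ^+ 2 = 1].

(* the Gram matrix of the inner product with orthonormal basis X_i, Z_i *)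
Definition std_ip : 'M[R]_8 := 1%:M.

Definition metric_rst (r s t : R) : V -> V -> V -> R :=
  left_invariant_metric (mu_rst r s t) std_ip.

End Example.

Arguments J1 {R}.
Arguments J2 {R}.
Arguments J3 {R}.
Arguments std_ip {R}.

(* Main.v *)
(* All compatible metrics are alike.  A metric commuting with J1, J2, J3 has
   scalar diagonal blocks on n_1 and n_2, so it is P^T P with P commuting with
   the J's, equal to q on n_2 and to p modulo n_2.  Since mu_rst factors through
   n_1 and takes values in n_2, P carries mu_rst to (q / p^2) mu_rst, and
   naturality gives Ric(mu_rst, P^T P) = P^-1 (q / p^2)^2 Ric(mu_rst, 1) P.
   Fixing the scalar curvature forces (q / p^2)^2 = 1, so tr (Ric^gamma)^2 is
   constant on the competitors.  The same formula, applied to the metric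
   phi^T phi induced by an isomorphism phi, shows that isomorphic hypercomplex
   structures have similar operators Ric(mu_rst, 1) =
   diag(-1/2, -1/2, -1/2, -1/2, 0, r^2, s^2, t^2), whose power traces determine
   (r, s, t).

   An isometry f pulls the left invariant coframe back to a coframe F with
   d F = mu'(F, F) and the Gram matrix of the standard coframe.  The Koszul
   formula and two differentiations express <R(F_w, F_v) F_u, F_z> through the
   Gram matrix, so the differential of f at 0 intertwines the curvature tensors,
   hence the Ricci operators, of the two Lie algebras. *)
Require Import Defs.
From HB Require Import structures.
From mathcomp Require Import all_boot all_order all_algebra.
From mathcomp Require Import all_classical all_reals all_analysis.
From mathcomp Require Import complex.
From mathcomp Require Import ring lra.

Set Implicit Arguments.
Unset Strict Implicit.
Unset Printing Implicit Defensive.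

Import Order.TTheory GRing.Theory Num.Theory.
Import numFieldNormedType.Exports.

Local Open Scope ring_scope.

(** * Bilinear forms and naturality of the Ricci operator *)

Section BilinearForms.
Variables (R : realType) (n : nat).
Local Notation V := 'cV[R]_n.+1.
Local Notation M := 'M[R]_n.+1.
Implicit Types (G H P : M) (x y z : V).

Definition bilin (W : lmodType R) (b : V -> V -> W) : Prop :=
  (forall (a : R) x x' y, b (a *: x + x') y = a *: b x y + b x' y) /\
  (forall (a : R) x y y', b x (a *: y + y') = a *: b x y + b x y').

Lemma cV_basis x : x = \sum_k x k 0 *: basis_vec R k.
Proof.
apply/matrixP => i j; rewrite summxE (bigD1 i) //= big1 ?addr0.
  by rewrite !mxE !ord1 !eqxx mulr1.
by move=> k /negbTE ki; rewrite !mxE eq_sym ki mulr0.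
Qed.

Section Linear.
Variables (W : lmodType R) (f : V -> W).
Hypothesis lf : forall (a : R) x x', f (a *: x + x') = a *: f x + f x'.

Lemma lin_fun0 : f 0 = 0.
Proof. by have := lf (-1) 0 0; rewrite scaler0 addr0 scaleN1r addNr. Qed.
Lemma lin_funD x y : f (x + y) = f x + f y.
Proof. by have := lf 1 x y; rewrite !scale1r. Qed.
Lemma lin_funZ a x : f (a *: x) = a *: f x.
Proof. by have := lf a x 0; rewrite lin_fun0 !addr0. Qed.
Lemma lin_funN x : f (- x) = - f x.
Proof. by rewrite -[- x]scaleN1r lin_funZ scaleN1r. Qed.
Lemma lin_funB x y : f (x - y) = f x - f y.
Proof. by rewrite lin_funD lin_funN. Qed.
Lemma lin_fun_sum (I : Type) (s : seq I) (F : I -> V) :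
  f (\sum_(i <- s) F i) = \sum_(i <- s) f (F i).
Proof. by elim/big_rec2: _ => [|i u v _ <-]; rewrite ?lin_fun0 ?lin_funD. Qed.
Lemma lin_fun_basis x : f x = \sum_k x k 0 *: f (basis_vec R k).
Proof.
rewrite {1}[x]cV_basis lin_fun_sum; by apply: eq_bigr => k _; rewrite lin_funZ.
Qed.
End Linear.

Section Bilinear.
Variables (W : lmodType R) (b : V -> V -> W).
Hypothesis lb : bilin b.
Let ll y := fun a x x' => lb.1 a x x' y.
Let lr x := fun a y y' => lb.2 a x y y'.
Lemma bilin0l y : b 0 y = 0. Proof. exact: lin_fun0 (ll y). Qed.
Lemma bilinDl x x' y : b (x + x') y = b x y + b x' y.
Proof. exact: lin_funD (ll y) _ _. Qed.
Lemma bilinDr x y y' : b x (y + y') = b x y + b x y'.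
Proof. exact: lin_funD (lr x) _ _. Qed.
Lemma bilinBl x x' y : b (x - x') y = b x y - b x' y.
Proof. exact: lin_funB (ll y) _ _. Qed.
Lemma bilinBr x y y' : b x (y - y') = b x y - b x y'.
Proof. exact: lin_funB (lr x) _ _. Qed.
Lemma bilinNl x y : b (- x) y = - b x y.
Proof. exact: lin_funN (ll y) _. Qed.
Lemma bilinNr x y : b x (- y) = - b x y.
Proof. exact: lin_funN (lr x) _. Qed.
Lemma bilinZl a x y : b (a *: x) y = a *: b x y.
Proof. exact: lin_funZ (ll y) _ _. Qed.
Lemma bilinZr a x y : b x (a *: y) = a *: b x y.
Proof. exact: lin_funZ (lr x) _ _. Qed.
Lemma bilin_basis x y :
  b x y = \sum_i \sum_j (x i 0 * y j 0) *: b (basis_vec R i) (basis_vec R j).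
Proof.
rewrite (lin_fun_basis (ll y)); apply: eq_bigr => i _.
rewrite (lin_fun_basis (lr _)) scaler_sumr; apply: eq_bigr => j _.
by rewrite scalerA.
Qed.
End Bilinear.

Lemma ip_bilin G : bilin (ip G : V -> V -> R^o).
Proof. by split=> a *; rewrite ?ipDl ?ipDr ?ipZl ?ipZr. Qed.

Lemma ip_basis G i j : ip G (basis_vec R i) (basis_vec R j) = G i j.
Proof. by rewrite /ip /basis_vec trmx_delta -rowE -colE !mxE. Qed.

Lemma ip_inj G H : (forall x y, ip G x y = ip H x y) -> G = H.
Proof. by move=> e; apply/matrixP => i j; rewrite -!ip_basis e. Qed.

Lemma ip_form (b : V -> V -> R) : bilin (b : V -> V -> R^o) ->
  forall x y, ip (\matrix_(i, j) b (basis_vec R i) (basis_vec R j)) x y = b x y.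
Proof.
move=> lb x y; rewrite (bilin_basis lb) (bilin_basis (ip_bilin _)).
by apply: eq_bigr => i _; apply: eq_bigr => j _; rewrite ip_basis mxE.
Qed.

Lemma ip_mulmx G P x y : ip G (P *m x) (P *m y) = ip (P^T *m G *m P) x y.
Proof. by rewrite /ip trmx_mul !mulmxA. Qed.

Lemma ip_nondeg G x y : inner_product G ->
  (forall z, ip G x z = ip G y z) -> x = y.
Proof.
move=> [_ Gp] e; apply/eqP; rewrite -subr_eq0; apply/negPn/negP => /Gp.
by rewrite (bilinBl (ip_bilin G)) e subrr ltxx.
Qed.

Lemma inner_product1 : inner_product (1%:M : M).
Proof.
split=> [|x x0]; first exact: trmx1.
have ipE : ip 1%:M x x = \sum_i x i 0 ^+ 2.
  by rewrite /ip mulmx1 mxE; apply: eq_bigr => i _; rewrite mxE expr2.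
rewrite ipE lt_neqAle sumr_ge0 ?andbT => [|i _]; last exact: sqr_ge0.
apply: contra x0 => /eqP/esym/eqP; rewrite psumr_eq0 => [/allP e|i _]; last first.
  exact: sqr_ge0.
apply/eqP/matrixP => i j; rewrite mxE ord1; apply/eqP; rewrite -sqrf_eq0.
by apply: e; rewrite mem_index_enum.
Qed.

Lemma inner_product_pull G P : inner_product G -> P \in unitmx ->
  inner_product (P^T *m G *m P).
Proof.
move=> [Gs Gp] Pu; split; first by rewrite !trmx_mul trmxK Gs mulmxA.
move=> x x0; rewrite -ip_mulmx Gp //; apply: contra x0 => /eqP e.
by rewrite -[x](mulKmx Pu) e mulmx0.
Qed.

Definition mx_of (f : V -> V) : M := \matrix_(i, j) f (basis_vec R j) i 0.

Lemma mx_ofE (f : V -> V) :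
  (forall (a : R) x x', f (a *: x + x') = a *: f x + f x') ->
  forall x, mx_of f *m x = f x.
Proof.
move=> lf x; rewrite (lin_fun_basis lf); apply/matrixP => i j.
rewrite summxE mxE; apply: eq_bigr => k _.
by rewrite !mxE !ord1 mulrC.
Qed.

Lemma mx_eqP P H : (forall x : V, P *m x = H *m x) -> P = H.
Proof.
move=> e; apply/matrixP => i j.
by have /matrixP/(_ i 0) := e (basis_vec R j); rewrite -!colE !mxE.
Qed.

End BilinearForms.

(** * The Levi-Civita connection of a bracket and its transport by isomorphisms *)

Section LeviCivita.
Variables (R : realType) (n : nat).
Local Notation V := 'cV[R]_n.+1.
Local Notation M := 'M[R]_n.+1.
Implicit Types (G H P : M) (x y z : V) (mu nu : V -> V -> V).

Lemma lie_bilin mu : is_lie_bracket mu -> bilin mu.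
Proof. by case. Qed.

Lemma lie_anti mu : is_lie_bracket mu -> forall x y, mu x y = - mu y x.
Proof.
move=> L x y; have lb := lie_bilin L; have [_ _ alt _] := L.
apply/eqP; rewrite -addr_eq0; have := alt (x + y).
by rewrite (bilinDl lb) !(bilinDr lb) !alt add0r addr0 => ->.
Qed.

Lemma nabla_bilin mu G : bilin mu -> bilin (nabla mu G).
Proof.
move=> lb; have lg := ip_bilin G.
split=> a *; rewrite /nabla scalemxAr -mulmxDr; congr (_ *m _); apply/matrixP => i j;
  rewrite !mxE !(bilinDl lb, bilinDr lb, bilinZl lb, bilinZr lb);
  by rewrite !(ipDl, ipDr, ipZl, ipZr); ring.
Qed.

Lemma curvature_lin1 mu G y z : bilin mu -> forall (a : R) x x',
  curvature mu G (a *: x + x') y z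
  = a *: curvature mu G x y z + curvature mu G x' y z.
Proof.
move=> lb a x x'; have ln := nabla_bilin G lb; rewrite /curvature.
rewrite !(bilinDl lb, bilinZl lb) !(bilinDl ln, bilinZl ln).
rewrite !(bilinDr ln, bilinZr ln).
repeat match goal with |- context [nabla ?m ?g ?u ?v] =>
  generalize (nabla m g u v); intro end.
by apply/matrixP => i j; rewrite !mxE; ring.
Qed.

Lemma curvature_lin2 mu G x z : bilin mu -> forall (a : R) y y',
  curvature mu G x (a *: y + y') z
  = a *: curvature mu G x y z + curvature mu G x y' z.
Proof.
move=> lb a y y'; have ln := nabla_bilin G lb; rewrite /curvature.
rewrite !(bilinDr lb, bilinZr lb) !(bilinDl ln, bilinZl ln).
rewrite !(bilinDr ln, bilinZr ln).
repeat match goal with |- context [nabla ?m ?g ?u ?v] =>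
  generalize (nabla m g u v); intro end.
by apply/matrixP => i j; rewrite !mxE; ring.
Qed.

Lemma curvature_lin3 mu G x y : bilin mu -> forall (a : R) z z',
  curvature mu G x y (a *: z + z')
  = a *: curvature mu G x y z + curvature mu G x y z'.
Proof.
move=> lb a z z'; have ln := nabla_bilin G lb; rewrite /curvature.
rewrite !(bilinDr ln, bilinZr ln).
repeat match goal with |- context [nabla ?m ?g ?u ?v] =>
  generalize (nabla m g u v); intro end.
by apply/matrixP => i j; rewrite !mxE; ring.
Qed.

Lemma ricci_tensor_bilin mu G :
  bilin mu -> bilin (ricci_tensor mu G : V -> V -> R^o).
Proof.
move=> lb; split=> a u v w; rewrite /ricci_tensor.
  rewrite scaler_sumr -big_split /=; apply: eq_bigr => k _.
  by rewrite curvature_lin2 // [LHS]mxE [X in X + _]mxE.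
rewrite scaler_sumr -big_split /=; apply: eq_bigr => k _.
by rewrite curvature_lin3 // [LHS]mxE [X in X + _]mxE.
Qed.

Lemma nabla_torsion mu G x y : is_lie_bracket mu -> inner_product G ->
  nabla mu G x y - nabla mu G y x = mu x y.
Proof.
move=> L Gi; apply: (ip_nondeg Gi) => z.
have lg := ip_bilin G; have lb := lie_bilin L.
have := nablaP x y z L Gi; have := nablaP y x z L Gi.
rewrite (bilinBl lg) [mu z x](lie_anti L) [mu y z](lie_anti L).
rewrite [mu y x](lie_anti L) !(bilinNl lg).
set a := ip _ _ _; set b := ip _ _ _; set c := ip _ _ _; set d := ip _ _ _.
by set e := ip _ _ _; lra.
Qed.

Lemma nabla_skew mu G x y z : is_lie_bracket mu -> inner_product G ->
  ip G (nabla mu G x y) z = - ip G y (nabla mu G x z).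
Proof.
move=> L Gi; have [Gs _] := Gi; rewrite [in RHS](ip_sym _ _ Gs).
have lg := ip_bilin G; have := nablaP x y z L Gi; have := nablaP x z y L Gi.
rewrite [mu y x](lie_anti L) [mu z y](lie_anti L) [mu x z](lie_anti L).
rewrite !(bilinNl lg); set a := ip _ _ _; set b := ip _ _ _; set c := ip _ _ _.
by set d := ip _ _ _; set e := ip _ _ _; lra.
Qed.

(** The Koszul formula expresses [nabla] through the bracket and the inner product alone, so an
    isometric isomorphism respects it. *)
Lemma nabla_transport mu nu G H P :
    is_lie_bracket mu -> is_lie_bracket nu ->
    inner_product G -> inner_product H -> P \in unitmx ->
    (forall x y, ip H (P *m x) (P *m y) = ip G x y) ->
    (forall x y, P *m mu x y = nu (P *m x) (P *m y)) ->
  forall x y, P *m nabla mu G x y = nabla nu H (P *m x) (P *m y).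
Proof.
move=> Lm Ln Gi Hi Pu eip emu x y; apply: (ip_nondeg Hi) => z.
rewrite -[z](mulKVmx Pu); set w := invmx P *m z; rewrite eip.
have := nablaP x y w Lm Gi.
have := nablaP (P *m x) (P *m y) (P *m w) Ln Hi.
rewrite -!emu !eip => <- /mulfI e; by rewrite e ?pnatr_eq0.
Qed.

Lemma curvature_transport mu nu G H P :
    is_lie_bracket mu -> is_lie_bracket nu ->
    inner_product G -> inner_product H -> P \in unitmx ->
    (forall x y, ip H (P *m x) (P *m y) = ip G x y) ->
    (forall x y, P *m mu x y = nu (P *m x) (P *m y)) ->
  forall x y z,
    P *m curvature mu G x y z = curvature nu H (P *m x) (P *m y) (P *m z).
Proof.
move=> Lm Ln Gi Hi Pu eip emu x y z.
have T := nabla_transport Lm Ln Gi Hi Pu eip emu.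
by rewrite /curvature !mulmxBr !T emu.
Qed.

(** The assumption bears on the curvature tensors and not on the brackets, because an isometry of
    groups is only shown to intertwine curvatures. For Lie algebra isomorphisms it is supplied by
    [curvature_transport]. *)
Lemma ricci_op_transport mu nu G H P :
    bilin mu -> bilin nu -> G \in unitmx -> H \in unitmx -> P \in unitmx ->
    (forall x y, ip H (P *m x) (P *m y) = ip G x y) ->
    (forall x y z,
      P *m curvature mu G x y z = curvature nu H (P *m x) (P *m y) (P *m z)) ->
  ricci_op mu G = invmx P *m ricci_op nu H *m P.
Proof.
move=> lm ln Gu Hu Pu eip ecurv.
have GE : G = P^T *m H *m P by apply: ip_inj => x y; rewrite -ip_mulmx eip.
(* The Ricci tensor is the trace of x -> R(x, y) z, and [P] conjugates one such endomorphism into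
   the other. *)
have ricE y z : ricci_tensor mu G y z = ricci_tensor nu H (P *m y) (P *m z).
  pose A := mx_of (fun x => curvature mu G x y z).
  pose B := mx_of (fun x => curvature nu H x (P *m y) (P *m z)).
  have -> : ricci_tensor mu G y z = \tr A.
    by apply: eq_bigr => k _; rewrite [RHS]mxE.
  have -> : ricci_tensor nu H (P *m y) (P *m z) = \tr B.
    by apply: eq_bigr => k _; rewrite [RHS]mxE.
  have <- : invmx P *m B *m P = A.
    apply: mx_eqP => x; rewrite -!mulmxA !mx_ofE => *; last 2 first.
    - exact: curvature_lin1.
    - exact: curvature_lin1.
    by rewrite -ecurv mulKmx.
  by rewrite mxtrace_mulC mulmxA mulmxV // mul1mx.
rewrite /ricci_op {1}GE.
set N := \matrix_(i, j) ricci_tensor nu H _ _.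
have -> : \matrix_(i, j) ricci_tensor mu G (basis_vec R i) (basis_vec R j)
    = P^T *m N *m P.
  apply: ip_inj => x y; rewrite ip_form; last exact: ricci_tensor_bilin.
  by rewrite -ip_mulmx ip_form ?ricE //; apply: ricci_tensor_bilin.
have PTu : P^T \in unitmx by rewrite unitmx_tr.
have Ku : P^T *m H *m P \in unitmx by rewrite !unitmx_mul PTu Hu.
apply: (can_inj (mulKmx Ku)); rewrite (mulKVmx Ku) -!mulmxA; congr (_ *m _).
by rewrite (mulKVmx Pu) (mulKVmx Hu).
Qed.

End LeviCivita.

(** * The Ricci operator of mu_rst *)

Ltac gen_coords x := repeat match goal with
  |- context [fun_of_matrix x ?i ?j] => generalize (fun_of_matrix x i j); intro
  end.

Section EightDim.
Variable R : realType.
Local Notation V := 'cV[R]_8.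
Local Notation M := 'M[R]_8.
Local Notation ix k := (@Ordinal 8 k isT).
Local Notation e_ := (@basis_vec R 7).

(** The cases are stated at the literal ordinals [ix k], on which the list lookups of [vec8] and
    [mx8] compute. *)
Lemma ord8_ind (P : 'I_8 -> Prop) :
  P (ix 0) -> P (ix 1) -> P (ix 2) -> P (ix 3) -> P (ix 4) -> P (ix 5) -> P (ix 6) -> P (ix 7) ->
  forall i, P i.
Proof.
move=> p0 p1 p2 p3 p4 p5 p6 p7 [[|[|[|[|[|[|[|[|m]]]]]]]] h] //;
  by rewrite (bool_irrelevance h isT).
Qed.

Lemma sum8 (F : 'I_8 -> R) : \sum_i F i =
  F (ix 0) + F (ix 1) + F (ix 2) + F (ix 3) + F (ix 4) + F (ix 5) + F (ix 6) + F (ix 7).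
Proof.
rewrite !big_ord_recl big_ord0 addr0 !addrA; do ?[congr (_ + _)];
  by congr F; apply: val_inj.
Qed.

Lemma inord8 k (h : (k < 8)%N) : inord k = Ordinal h :> 'I_8.
Proof. exact/val_inj/inordK. Qed.

Lemma inord8E : ((inord 0 = (ix 0)) * (inord 1 = (ix 1)) * (inord 2 = (ix 2)) *
  (inord 3 = (ix 3)) * (inord 4 = (ix 4)) * (inord 5 = (ix 5)) * (inord 6 = (ix 6)) *
  (inord 7 = (ix 7)))%type.
Proof. by do !split; exact: inord8. Qed.

Definition vec8 (l : seq R) : V := \col_i nth 0 l i.
Definition mx8 (l : seq (seq R)) : M := \matrix_(i, j) nth 0 (nth [::] l i) j.

Lemma vec8E l i : vec8 l i 0 = nth 0 l i. Proof. exact: mxE. Qed.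
Lemma basis8E i j : e_ i j 0 = (j == i)%:R.
Proof. by rewrite mxE eqxx andbT. Qed.

Lemma cV8P (x y : V) :
  x (ix 0) 0 = y (ix 0) 0 -> x (ix 1) 0 = y (ix 1) 0 -> x (ix 2) 0 = y (ix 2) 0 ->
  x (ix 3) 0 = y (ix 3) 0 -> x (ix 4) 0 = y (ix 4) 0 -> x (ix 5) 0 = y (ix 5) 0 ->
  x (ix 6) 0 = y (ix 6) 0 -> x (ix 7) 0 = y (ix 7) 0 -> x = y.
Proof.
move=> *; apply/matrixP => i j; rewrite ord1; move: i; exact: ord8_ind.
Qed.

Lemma ip1E (x y : V) : ip 1%:M x y =
  x (ix 0) 0 * y (ix 0) 0 + x (ix 1) 0 * y (ix 1) 0 + x (ix 2) 0 * y (ix 2) 0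
  + x (ix 3) 0 * y (ix 3) 0 + x (ix 4) 0 * y (ix 4) 0 + x (ix 5) 0 * y (ix 5) 0
  + x (ix 6) 0 * y (ix 6) 0 + x (ix 7) 0 * y (ix 7) 0.
Proof. by rewrite /ip mulmx1 mxE sum8 !mxE. Qed.

Lemma mu_rstE r s t (x y : V) : mu_rst r s t x y =
  vec8 [:: 0; 0; 0; 0; 0;
    r * ((x (ix 0) 0 * y (ix 1) 0 - x (ix 1) 0 * y (ix 0) 0)
         - (x (ix 2) 0 * y (ix 3) 0 - x (ix 3) 0 * y (ix 2) 0));
    s * ((x (ix 0) 0 * y (ix 2) 0 - x (ix 2) 0 * y (ix 0) 0)
         + (x (ix 1) 0 * y (ix 3) 0 - x (ix 3) 0 * y (ix 1) 0));
    t * ((x (ix 0) 0 * y (ix 3) 0 - x (ix 3) 0 * y (ix 0) 0)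
         - (x (ix 1) 0 * y (ix 2) 0 - x (ix 2) 0 * y (ix 1) 0))].
Proof.
rewrite /mu_rst /minor /Z /= !inord8E.
by apply: cV8P; rewrite !mxE /= ?(mulr0, mulr1, addr0, add0r).
Qed.

Definition symprod (x y : V) (i j : 'I_8) : R :=
  x i 0 * y j 0 + y i 0 * x j 0.

(** The n_2 part is half the bracket. The n_1 part is symmetric in x and y and pairs a coordinate in
    n_2 with one in n_1, as in every two-step algebra. The formula is checked against the Koszul
    formula. *)
Lemma nabla_rstE r s t (x y : V) : nabla (mu_rst r s t) 1%:M x y =
  vec8 [::
   2^-1 * (r * symprod x y (ix 5) (ix 1) + s * symprod x y (ix 6) (ix 2) + t * symprod x y (ix 7) (ix 3));
   2^-1 * (- (r * symprod x y (ix 5) (ix 0)) + s * symprod x y (ix 6) (ix 3) - t * symprod x y (ix 7) (ix 2));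
   2^-1 * (- (r * symprod x y (ix 5) (ix 3)) - s * symprod x y (ix 6) (ix 0) + t * symprod x y (ix 7) (ix 1));
   2^-1 * (r * symprod x y (ix 5) (ix 2) - s * symprod x y (ix 6) (ix 1) - t * symprod x y (ix 7) (ix 0));
   0;
   2^-1 * (r * ((x (ix 0) 0 * y (ix 1) 0 - x (ix 1) 0 * y (ix 0) 0)
     - (x (ix 2) 0 * y (ix 3) 0 - x (ix 3) 0 * y (ix 2) 0)));
   2^-1 * (s * ((x (ix 0) 0 * y (ix 2) 0 - x (ix 2) 0 * y (ix 0) 0)
     + (x (ix 1) 0 * y (ix 3) 0 - x (ix 3) 0 * y (ix 1) 0)));
   2^-1 * (t * ((x (ix 0) 0 * y (ix 3) 0 - x (ix 3) 0 * y (ix 0) 0)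
     - (x (ix 1) 0 * y (ix 2) 0 - x (ix 2) 0 * y (ix 1) 0)))].
Proof.
have [L _] := mu_rst_lie_two_step r s t.
apply: (ip_nondeg (inner_product1 R 7)) => z.
have two0 : (2 : R) != 0 by rewrite pnatr_eq0.
apply: (mulfI two0); rewrite (nablaP x y z L (inner_product1 R 7)).
rewrite !ip1E !mu_rstE !vec8E /= /symprod.
by gen_coords x; gen_coords y; gen_coords z; field.
Qed.

(** This is the divergence of the left invariant field u, zero because nilpotent groups are
    unimodular. With u = nabla_y z it removes the first term of the Ricci contraction; the next two
    lemmas compute the other two. *)
Lemma div_nabla_rst r s t (u : V) :
  \sum_k nabla (mu_rst r s t) 1%:M (e_ k) u k 0 = 0.
Proof.
rewrite sum8 !nabla_rstE !vec8E /= /symprod !basis8E /=.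
by ring.
Qed.

Lemma tr_nabla_bracket_rst r s t (y z : V) :
  \sum_k nabla (mu_rst r s t) 1%:M (mu_rst r s t (e_ k) y) z k 0 =
  2^-1 * (r ^+ 2 + s ^+ 2 + t ^+ 2) * (y (ix 0) 0 * z (ix 0) 0
    + y (ix 1) 0 * z (ix 1) 0 + y (ix 2) 0 * z (ix 2) 0 + y (ix 3) 0 * z (ix 3) 0).
Proof.
rewrite sum8 !mu_rstE !basis8E /= ?(mul0r, mul1r, subr0, sub0r, addr0, oppr0, mulr0).
rewrite !nabla_rstE !vec8E /= /symprod !vec8E /=.
by gen_coords y; gen_coords z; ring.
Qed.

Lemma tr_nabla_nabla_rst r s t (y z : V) :
  \sum_k nabla (mu_rst r s t) 1%:M y (nabla (mu_rst r s t) 1%:M (e_ k) z) k 0 =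
  - (r ^+ 2 * (y (ix 5) 0 * z (ix 5) 0) + s ^+ 2 * (y (ix 6) 0 * z (ix 6) 0)
     + t ^+ 2 * (y (ix 7) 0 * z (ix 7) 0)).
Proof.
rewrite sum8 ![nabla _ _ (e_ _) _]nabla_rstE /symprod !basis8E /=.
rewrite ?(mul0r, mulr0, mul1r, mulr1, addr0, add0r, oppr0, subr0, sub0r).
gen_coords z; rewrite !nabla_rstE !vec8E /= /symprod !vec8E /=; gen_coords y.
by field.
Qed.

Lemma ricci_tensor_rst r s t (y z : V) :
  ricci_tensor (mu_rst r s t) 1%:M y z =
  - (2^-1 * (r ^+ 2 + s ^+ 2 + t ^+ 2))
    * (y (ix 0) 0 * z (ix 0) 0 + y (ix 1) 0 * z (ix 1) 0
       + y (ix 2) 0 * z (ix 2) 0 + y (ix 3) 0 * z (ix 3) 0)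
  + r ^+ 2 * (y (ix 5) 0 * z (ix 5) 0) + s ^+ 2 * (y (ix 6) 0 * z (ix 6) 0)
  + t ^+ 2 * (y (ix 7) 0 * z (ix 7) 0).
Proof.
have cE (u v : V) k : (u - v) k 0 = u k 0 - v k 0 by rewrite !mxE.
rewrite /ricci_tensor /curvature.
under eq_bigr => k _ do rewrite !cE.
rewrite !sumrB div_nabla_rst tr_nabla_nabla_rst tr_nabla_bracket_rst.
by ring.
Qed.

(** Kept homogeneous of degree two in (r, s, t), so that it also covers the rescaled bracket with
    parameters (c r, c s, c t). *)
Definition ric_diag (r s t : R) : 'rV[R]_8 :=
  let a := - (2^-1 * (r ^+ 2 + s ^+ 2 + t ^+ 2)) in
  \row_i nth 0 [:: a; a; a; a; 0; r ^+ 2; s ^+ 2; t ^+ 2] i.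

Lemma ricci_op_rst r s t :
  ricci_op (mu_rst r s t) 1%:M = diag_mx (ric_diag r s t).
Proof.
rewrite /ricci_op invmx1 mul1mx; apply/matrixP => i j; rewrite mxE ricci_tensor_rst !basis8E.
move: i j; apply: ord8_ind; apply: ord8_ind; rewrite !mxE /=;
  by rewrite ?(mul0r, mulr0, mul1r, mulr1, addr0, add0r, oppr0, subr0, mulr1n).
Qed.
End EightDim.

(** * The hypercomplex structure *)

Section Quaternionic.
Variable R : realType.
Local Notation V := 'cV[R]_8.
Local Notation M := 'M[R]_8.
Local Notation ix k := (@Ordinal 8 k isT).
Local Notation e_ := (@basis_vec R 7).

Lemma mx8E (l : seq (seq R)) i j : mx8 l i j = nth 0 (nth [::] l i) j.
Proof. exact: mxE. Qed.

Lemma delta_mx_vec (i j : 'I_8) (x : V) : delta_mx i j *m x = x j 0 *: e_ i.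
Proof.
apply/matrixP => a b; rewrite !mxE ord1 eqxx andbT.
rewrite (bigD1 j) //= big1 ?addr0 => [|k /negbTE kj].
  by rewrite mxE eqxx andbT mulrC.
by rewrite mxE kj andbF mul0r.
Qed.

Lemma mx8_vec (l : seq (seq R)) (x : V) : mx8 l *m x = vec8 [seq
  \sum_(k < 8) nth 0 (nth [::] l i) k * x k 0 | i <- iota 0 8].
Proof.
by apply: cV8P; rewrite mxE vec8E /=; apply: eq_bigr => k _; rewrite mx8E.
Qed.

Lemma J1_vec (x : V) : J1 *m x = vec8 [::
  - x (ix 1) 0; x (ix 0) 0; - x (ix 3) 0; x (ix 2) 0;
  - x (ix 5) 0; x (ix 4) 0; - x (ix 7) 0; x (ix 6) 0].
Proof.
rewrite /J1 /E !(mulmxDl, mulNmx) !delta_mx_vec /= !inord8E.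
by apply: cV8P; rewrite vec8E !mxE /= ?(mulr0, mulr1, addr0, add0r, oppr0).
Qed.

Lemma J2_vec (x : V) : J2 *m x = vec8 [::
  - x (ix 2) 0; x (ix 3) 0; x (ix 0) 0; - x (ix 1) 0;
  - x (ix 6) 0; x (ix 7) 0; x (ix 4) 0; - x (ix 5) 0].
Proof.
rewrite /J2 /E !(mulmxDl, mulNmx) !delta_mx_vec /= !inord8E.
by apply: cV8P; rewrite vec8E !mxE /= ?(mulr0, mulr1, addr0, add0r, oppr0).
Qed.

Lemma J3_vec (x : V) : J3 *m x = vec8 [::
  - x (ix 3) 0; - x (ix 2) 0; x (ix 1) 0; x (ix 0) 0;
  - x (ix 7) 0; - x (ix 6) 0; x (ix 5) 0; x (ix 4) 0].
Proof.
by rewrite /J3 -mulmxA J2_vec J1_vec !vec8E /= ?opprK.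
Qed.

Lemma J_sqr : [/\ J1 *m J1 = - 1%:M :> M, J2 *m J2 = - 1%:M :> M & J3 *m J3 = - 1%:M :> M].
Proof.
by split; apply: mx_eqP => x; rewrite mulNmx mul1mx -mulmxA ?J1_vec ?J2_vec ?J3_vec;
  apply: cV8P; rewrite vec8E /= ?vec8E /= mxE // opprK.
Qed.

Lemma J12_anti : J3 = - (J2 *m J1) :> M.
Proof.
apply: mx_eqP => x; rewrite mulNmx -(mulmxA J2) J1_vec J2_vec J3_vec.
by apply: cV8P; rewrite !mxE /= ?opprK.
Qed.

Lemma abelian_rst r s t :
  [/\ abelian_cplx (mu_rst r s t : V -> V -> V) J1,
      abelian_cplx (mu_rst r s t : V -> V -> V) J2
    & abelian_cplx (mu_rst r s t : V -> V -> V) J3].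
Proof.
by split=> x y; rewrite !mu_rstE ?J1_vec ?J2_vec ?J3_vec; apply: cV8P;
  rewrite [LHS]vec8E [RHS]vec8E /= ?vec8E /=; gen_coords x; gen_coords y; ring.
Qed.

(** Applying the abelian condition to (x, J y) gives mu(x, J y) = - mu(J x, y), so the two extra
    terms of the integrability condition cancel. *)
Lemma abelian_integrable (n : nat) (mu : 'cV[R]_n.+1 -> 'cV[R]_n.+1 -> 'cV[R]_n.+1)
    (J : 'M[R]_n.+1) :
  bilin mu -> J *m J = - 1%:M -> abelian_cplx mu J -> Defs.integrable mu J.
Proof.
move=> lb JJ ab x y; rewrite ab -[mu x (J *m y)]ab !mulmxA JJ mulNmx mul1mx.
by rewrite (bilinNr lb) mulmxN addrK.
Qed.

Lemma abelian_hypercomplex_rst r s t :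
  abelian_hypercomplex (mu_rst r s t : V -> V -> V) J1 J2 J3.
Proof.
have [L _] := mu_rst_lie_two_step r s t; have lb := lie_bilin L.
have [s1 s2 s3] := J_sqr; have [a1 a2 a3] := abelian_rst r s t.
split; last by [].
split; first by [].
  by split; [|exact: J12_anti].
by split; apply: abelian_integrable.
Qed.

Lemma std_compatible : compatible_metric J1 J2 J3 (1%:M : M).
Proof.
split; first exact: inner_product1.
by split=> x y; rewrite !ip1E ?J1_vec ?J2_vec ?J3_vec !vec8E /=; ring.
Qed.

End Quaternionic.

(** * Compatible metrics *)

Section CompatibleMetrics.
Variable R : realType.
Local Notation V := 'cV[R]_8.
Local Notation M := 'M[R]_8.
Local Notation ix k := (@Ordinal 8 k isT).
Local Notation e_ := (@basis_vec R 7).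

(** Each of [J1], [J2], [J3], indexed by l = 0, 1, 2, permutes the basis up to sign. Tabulating
    signs and permutations turns the hermitian condition into explicit relations between entries of
    the Gram matrix. *)
Definition cplx_signs (l : nat) : seq R :=
  nth [::] [:: [:: 1; -1; 1; -1; 1; -1; 1; -1]; [:: 1; -1; -1; 1; 1; -1; -1; 1];
               [:: 1; 1; -1; -1; 1; 1; -1; -1]] l.
Definition cplx_perm (l : nat) : seq 'I_8 :=
  nth [::] [:: [:: ix 1; ix 0; ix 3; ix 2; ix 5; ix 4; ix 7; ix 6];
               [:: ix 2; ix 3; ix 0; ix 1; ix 6; ix 7; ix 4; ix 5];
               [:: ix 3; ix 2; ix 1; ix 0; ix 7; ix 6; ix 5; ix 4]] l.
Definition cplx (l : nat) : M := nth 0 [:: J1; J2; J3] l.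

Lemma cplx_basis l i : (l < 3)%N ->
  cplx l *m e_ i = nth 0 (cplx_signs l) i *: e_ (nth ord0 (cplx_perm l) i).
Proof.
case: l => [|[|[|//]]] _; rewrite /cplx /= ?J1_vec ?J2_vec ?J3_vec;
  move: i; apply: ord8_ind; apply: cV8P;
  by rewrite vec8E [RHS]mxE /= !basis8E /= ?(mulr0, mulr1, oppr0).
Qed.

Lemma hermitian_entries G l i j : (l < 3)%N -> hermitian_for (cplx l) G ->
  G i j = nth 0 (cplx_signs l) i * nth 0 (cplx_signs l) j
          * G (nth ord0 (cplx_perm l) i) (nth ord0 (cplx_perm l) j).
Proof.
move=> l3 hG; rewrite -ip_basis -hG !cplx_basis // ipZl ipZr ip_basis.
by rewrite mulrA.
Qed.

(* The columns of the lower left block are c, J1 c, J2 c, J3 c, so that it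
   commutes with the J's. *)
Definition block_tri (p q c0 c1 c2 c3 : R) : M := mx8 [::
  [:: p; 0; 0; 0; 0; 0; 0; 0]; [:: 0; p; 0; 0; 0; 0; 0; 0];
  [:: 0; 0; p; 0; 0; 0; 0; 0]; [:: 0; 0; 0; p; 0; 0; 0; 0];
  [:: c0; - c1; - c2; - c3; q; 0; 0; 0]; [:: c1; c0; c3; - c2; 0; q; 0; 0];
  [:: c2; - c3; c0; c1; 0; 0; q; 0]; [:: c3; c2; - c1; c0; 0; 0; 0; q]].

Lemma block_tri_vec p q c0 c1 c2 c3 (x : V) :
  block_tri p q c0 c1 c2 c3 *m x = vec8 [::
    p * x (ix 0) 0; p * x (ix 1) 0; p * x (ix 2) 0; p * x (ix 3) 0;
    c0 * x (ix 0) 0 - c1 * x (ix 1) 0 - c2 * x (ix 2) 0 - c3 * x (ix 3) 0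
      + q * x (ix 4) 0;
    c1 * x (ix 0) 0 + c0 * x (ix 1) 0 + c3 * x (ix 2) 0 - c2 * x (ix 3) 0
      + q * x (ix 5) 0;
    c2 * x (ix 0) 0 - c3 * x (ix 1) 0 + c0 * x (ix 2) 0 + c1 * x (ix 3) 0
      + q * x (ix 6) 0;
    c3 * x (ix 0) 0 + c2 * x (ix 1) 0 - c1 * x (ix 2) 0 + c0 * x (ix 3) 0
      + q * x (ix 7) 0].
Proof.
rewrite /block_tri mx8_vec /=; apply: cV8P; rewrite !vec8E /= sum8 /=;
 by rewrite ?(mul0r, addr0, add0r, mulNr).
Qed.

Lemma block_tri_comm p q c0 c1 c2 c3 (P := block_tri p q c0 c1 c2 c3) :
  [/\ P *m J1 = J1 *m P, P *m J2 = J2 *m P & P *m J3 = J3 *m P].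
Proof.
have h1 : P *m J1 = J1 *m P.
  apply: mx_eqP => x; rewrite -!mulmxA J1_vec [RHS]J1_vec !block_tri_vec.
  by apply: cV8P; rewrite [LHS]vec8E [RHS]vec8E /= ?vec8E /=; gen_coords x; ring.
have h2 : P *m J2 = J2 *m P.
  apply: mx_eqP => x; rewrite -!mulmxA J2_vec [RHS]J2_vec !block_tri_vec.
  by apply: cV8P; rewrite [LHS]vec8E [RHS]vec8E /= ?vec8E /=; gen_coords x; ring.
by split=> //; rewrite /J3 mulmxA h1 -!mulmxA h2.
Qed.

Lemma block_tri_unit p q c0 c1 c2 c3 : p != 0 -> q != 0 ->
  block_tri p q c0 c1 c2 c3 \in unitmx.
Proof.
move=> p0 q0; set P := block_tri _ _ _ _ _ _.
(* The inverse of a lower triangular block matrix with scalar diagonal blocks p, q and lower left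
   block C has lower left block - C / (p q), hence is of the same form. *)
pose Q := block_tri p^-1 q^-1 (- (c0 / (p * q))) (- (c1 / (p * q)))
  (- (c2 / (p * q))) (- (c3 / (p * q))).
have PQ : P *m Q = 1%:M.
  apply: mx_eqP => x; rewrite mul1mx -mulmxA !block_tri_vec.
  by apply: cV8P; rewrite vec8E /= ?vec8E /=; gen_coords x; field; rewrite ?p0 ?q0.
by have [] := mulmx1_unit PQ.
Qed.

(** The bracket sees its arguments only modulo n_2, where P is p, and takes values in n_2, where P
    is q. *)
Lemma block_tri_bracket p q c0 c1 c2 c3 r s t (x y : V)
    (c := q / p ^+ 2) (P := block_tri p q c0 c1 c2 c3) : p != 0 ->
  P *m mu_rst r s t x y = mu_rst (c * r) (c * s) (c * t) (P *m x) (P *m y).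
Proof.
move=> p0; rewrite /c /P !mu_rstE !block_tri_vec.
by apply: cV8P; rewrite [LHS]vec8E [RHS]vec8E /= ?vec8E /=; gen_coords x; gen_coords y; field.
Qed.

(** A Cholesky factorisation over the quaternions: a compatible metric amounts to a positive
    hermitian 2 x 2 quaternionic matrix with real diagonal a, d and off-diagonal entry (k0, k1, k2,
    k3), and [block_tri] is its triangular factor. *)
Lemma compatible_block_tri G : compatible_metric J1 J2 J3 G ->
  exists p q c0 c1 c2 c3 : R, [/\ 0 < p, 0 < q &
    forall x y : V, ip 1%:M (block_tri p q c0 c1 c2 c3 *m x)
                            (block_tri p q c0 c1 c2 c3 *m y) = ip G x y].
Proof.
move=> [[Gs Gp] [H1 H2 H3]].
have S i j : G i j = G j i by rewrite -{1}Gs mxE.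
have F1 i j := @hermitian_entries G 0 i j isT H1.
have F2 i j := @hermitian_entries G 1 i j isT H2.
have F3 i j := @hermitian_entries G 2 i j isT H3.
(* G is the average of its pull-backs by 1, J1, J2, J3. *)
have K : forall i j, G i j = 4^-1 * (G i j +
    nth 0 (cplx_signs 0) i * nth 0 (cplx_signs 0) j
          * G (nth ord0 (cplx_perm 0) i) (nth ord0 (cplx_perm 0) j) +
    nth 0 (cplx_signs 1) i * nth 0 (cplx_signs 1) j
          * G (nth ord0 (cplx_perm 1) i) (nth ord0 (cplx_perm 1) j) +
    nth 0 (cplx_signs 2) i * nth 0 (cplx_signs 2) j
          * G (nth ord0 (cplx_perm 2) i) (nth ord0 (cplx_perm 2) j)).
  by move=> i j; rewrite -F1 -F2 -F3; field.
pose a := G (ix 0) (ix 0); pose d := G (ix 4) (ix 4).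
pose k0 := G (ix 0) (ix 4); pose k1 := G (ix 0) (ix 5).
pose k2 := G (ix 0) (ix 6); pose k3 := G (ix 0) (ix 7).
(* Rewriting with [SS] moves every entry below the diagonal to the upper triangle, so that [ring]
   sees one variable per symmetric pair. *)
have SS := (
  S (ix 1) (ix 0), S (ix 2) (ix 0), S (ix 2) (ix 1), S (ix 3) (ix 0),
  S (ix 3) (ix 1), S (ix 3) (ix 2), S (ix 4) (ix 0), S (ix 4) (ix 1),
  S (ix 4) (ix 2), S (ix 4) (ix 3), S (ix 5) (ix 0), S (ix 5) (ix 1),
  S (ix 5) (ix 2), S (ix 5) (ix 3), S (ix 5) (ix 4), S (ix 6) (ix 0),
  S (ix 6) (ix 1), S (ix 6) (ix 2), S (ix 6) (ix 3), S (ix 6) (ix 4),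
  S (ix 6) (ix 5), S (ix 7) (ix 0), S (ix 7) (ix 1), S (ix 7) (ix 2),
  S (ix 7) (ix 3), S (ix 7) (ix 4), S (ix 7) (ix 5), S (ix 7) (ix 6)).
(* In the average [K], the off-diagonal entries of the two diagonal blocks cancel in pairs, which
   makes these blocks scalar; the mixed block is determined by its first row. *)
have GE : G = mx8 [::
  [:: a; 0; 0; 0; k0; k1; k2; k3];
  [:: 0; a; 0; 0; - k1; k0; - k3; k2];
  [:: 0; 0; a; 0; - k2; k3; k0; - k1];
  [:: 0; 0; 0; a; - k3; - k2; k1; k0];
  [:: k0; - k1; - k2; - k3; d; 0; 0; 0];
  [:: k1; k0; k3; - k2; 0; d; 0; 0];
  [:: k2; - k3; k0; k1; 0; 0; d; 0];
  [:: k3; k2; - k1; k0; 0; 0; 0; d]].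
  by apply/matrixP; apply: ord8_ind; apply: ord8_ind;
    rewrite mx8E /= /a /d /k0 /k1 /k2 /k3 1?[in RHS]K [in LHS]K /= ?SS;
    gen_coords G; ring.
have d0 : 0 < d by rewrite /d -ip_basis; apply: Gp; apply/eqP => /matrixP/(_ (ix 4) 0)/eqP;
    rewrite basis8E mxE /= oner_eq0.
pose q := Num.sqrt d.
have q0 : 0 < q by rewrite sqrtr_gt0.
have qq : q ^+ 2 = d by exact: sqr_sqrtr (ltW d0).
have GV (x : V) : G *m x = vec8 [::
    a * x (ix 0) 0 + k0 * x (ix 4) 0 + k1 * x (ix 5) 0 + k2 * x (ix 6) 0 + k3 * x (ix 7) 0;
    a * x (ix 1) 0 - k1 * x (ix 4) 0 + k0 * x (ix 5) 0 - k3 * x (ix 6) 0 + k2 * x (ix 7) 0;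
    a * x (ix 2) 0 - k2 * x (ix 4) 0 + k3 * x (ix 5) 0 + k0 * x (ix 6) 0 - k1 * x (ix 7) 0;
    a * x (ix 3) 0 - k3 * x (ix 4) 0 - k2 * x (ix 5) 0 + k1 * x (ix 6) 0 + k0 * x (ix 7) 0;
    k0 * x (ix 0) 0 - k1 * x (ix 1) 0 - k2 * x (ix 2) 0 - k3 * x (ix 3) 0 + d * x (ix 4) 0;
    k1 * x (ix 0) 0 + k0 * x (ix 1) 0 + k3 * x (ix 2) 0 - k2 * x (ix 3) 0 + d * x (ix 5) 0;
    k2 * x (ix 0) 0 - k3 * x (ix 1) 0 + k0 * x (ix 2) 0 + k1 * x (ix 3) 0 + d * x (ix 6) 0;
    k3 * x (ix 0) 0 + k2 * x (ix 1) 0 - k1 * x (ix 2) 0 + k0 * x (ix 3) 0 + d * x (ix 7) 0].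
  rewrite GE mx8_vec /=; apply: cV8P; rewrite !vec8E /= sum8 /=;
   by rewrite ?(mul0r, addr0, add0r, mulNr).
have ipG (x y : V) : ip G x y = ip 1%:M x (G *m y) by rewrite /ip mulmx1 mulmxA.
have pp0 : 0 < a - (k0 ^+ 2 + k1 ^+ 2 + k2 ^+ 2 + k3 ^+ 2) / d.
  (* The component of X_1 orthogonal to n_2 for [G]; its squared length is the Schur complement of
     d. *)
  pose x : V := vec8 [:: 1; 0; 0; 0; - (k0 / d); - (k1 / d); - (k2 / d); - (k3 / d)].
  have x0 : x != 0.
    by apply/eqP => /matrixP/(_ (ix 0) 0)/eqP; rewrite vec8E mxE /= oner_eq0.
  have := Gp x x0; rewrite ipG GV ip1E !vec8E /=; congr (0 < _).
  by field; rewrite gt_eqF.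
pose p := Num.sqrt (a - (k0 ^+ 2 + k1 ^+ 2 + k2 ^+ 2 + k3 ^+ 2) / d).
have p0 : 0 < p by rewrite sqrtr_gt0.
have pp : a = p ^+ 2 + (k0 ^+ 2 + k1 ^+ 2 + k2 ^+ 2 + k3 ^+ 2) / q ^+ 2.
  have -> : p ^+ 2 = a - (k0 ^+ 2 + k1 ^+ 2 + k2 ^+ 2 + k3 ^+ 2) / d.
    exact: sqr_sqrtr (ltW pp0).
  by rewrite qq; ring.
(* Comparing P^T P with [G] block by block gives q^2 = d, then q C = K for the lower left block,
   then p^2 as the Schur complement. *)
exists p, q, (k0 / q), (k1 / q), (k2 / q), (k3 / q); split=> // x y.
rewrite ipG GV !ip1E !block_tri_vec !vec8E /= pp -qq.
by gen_coords x; gen_coords y; field; rewrite gt_eqF.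
Qed.

End CompatibleMetrics.

(** * Minimality, and recovery of (r, s, t) from the Ricci operator *)

Section RicciInvariants.
Variable R : realType.
Local Notation V := 'cV[R]_8.
Local Notation M := 'M[R]_8.

Lemma tr_ric_diag (r s t : R) :
  \tr (diag_mx (ric_diag r s t)) = - (r ^+ 2 + s ^+ 2 + t ^+ 2).
Proof. by rewrite mxtrace_diag sum8 !mxE /=; field. Qed.

Lemma ricci_compatible (G : M) : compatible_metric J1 J2 J3 G ->
  exists P c, [/\ P \in unitmx,
    [/\ P *m J1 = J1 *m P, P *m J2 = J2 *m P & P *m J3 = J3 *m P] &
    forall r s t : R, ricci_op (mu_rst r s t) G
      = invmx P *m (c ^+ 2 *: diag_mx (ric_diag r s t)) *m P].
Proof.
move=> cG; have [p [q [c0 [c1 [c2 [c3 [p0 q0 ipE]]]]]]] := compatible_block_tri cG.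
have Pu := block_tri_unit c0 c1 c2 c3 (lt0r_neq0 p0) (lt0r_neq0 q0).
have Pc := block_tri_comm p q c0 c1 c2 c3.
have Pb := fun r s t x y => block_tri_bracket q c0 c1 c2 c3 r s t x y (lt0r_neq0 p0).
move: (block_tri _ _ _ _ _ _) ipE Pu Pc Pb => P ipE Pu Pc Pb.
exists P, (q / p ^+ 2); split=> // r s t; set c := q / p ^+ 2.
have [L _] := mu_rst_lie_two_step r s t.
have [L' _] := mu_rst_lie_two_step (c * r) (c * s) (c * t).
have [Gi _] := cG; have I1 := inner_product1 R 7.
rewrite (ricci_op_transport (lie_bilin L) (lie_bilin L') (inner_product_unit Gi)
  (inner_product_unit I1) Pu ipE
  (curvature_transport L L' Gi I1 Pu ipE (Pb r s t))).
rewrite ricci_op_rst; congr (_ *m _ *m _).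
(* The Ricci operator is quadratic in the bracket, whence the factor c^2. *)
apply/matrixP => i j; rewrite !mxE mulrnAr; congr (_ *+ _).
by move: i {j}; apply: ord8_ind => /=; ring.
Qed.

Lemma minimal_rst r s t : r ^+ 2 + s ^+ 2 + t ^+ 2 = 1 ->
  minimal_metric (mu_rst r s t : V -> V -> V) J1 J2 J3 std_ip.
Proof.
move=> rst1; split=> [|G cG]; first exact: std_compatible.
have [P [c [Pu [P1 P2 P3] ricE]]] := ricci_compatible cG.
have trconj (A : M) : \tr (invmx P *m A *m P) = \tr A.
  by rewrite mxtrace_mulC mulmxA mulmxV // mul1mx.
rewrite /scalar_curvature ricE trconj /std_ip ricci_op_rst mxtraceZ tr_ric_diag rst1.
move=> cc; have {cc} c1 : c ^+ 2 = 1 by apply: oppr_inj; rewrite -cc mulrN1.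
(* As [P] commutes with the J's, conjugation by [P] commutes with the averaging that defines the
   invariant Ricci operator. The two operators are then similar, and the required inequality is an
   equality. *)
suff -> : invariant_ricci (mu_rst r s t) J1 J2 J3 G
    = invmx P *m invariant_ricci (mu_rst r s t) J1 J2 J3 1%:M *m P.
  rewrite /tr_sq -!mulmxA (mulKVmx Pu) [X in _ <= \tr X]mulmxA.
  by rewrite [X in _ <= \tr X]mulmxA -[invmx P *m _ *m _]mulmxA trconj.
rewrite /invariant_ricci ricE ricci_op_rst c1 scale1r.
set D := diag_mx _; rewrite -scalemxAr -scalemxAl; congr (_ *: _).
have JP (J : M) : P *m J = J *m P -> J *m invmx P = invmx P *m J.
  by move=> e; apply: (can_inj (mulKmx Pu)); rewrite mulKVmx // mulmxA e mulmxK.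
have conjJ (J : M) : P *m J = J *m P ->
    J *m (invmx P *m D *m P) *m J = invmx P *m (J *m D *m J) *m P.
  by move=> e; rewrite !mulmxA JP // -!mulmxA e.
by rewrite (conjJ _ P1) (conjJ _ P2) (conjJ _ P3) !(mulmxBr, mulmxBl).
Qed.

(** By Newton's identities the power sums determine the elementary symmetric functions, so the two
    triples are the roots of the same cubic. *)
Lemma sorted_power_sums (a b c a' b' c' : R) :
  a <= b -> b <= c -> a' <= b' -> b' <= c' -> a + b + c = a' + b' + c' ->
  a ^+ 2 + b ^+ 2 + c ^+ 2 = a' ^+ 2 + b' ^+ 2 + c' ^+ 2 ->
  a ^+ 3 + b ^+ 3 + c ^+ 3 = a' ^+ 3 + b' ^+ 3 + c' ^+ 3 ->
  [/\ a = a', b = b' & c = c'].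
Proof.
move=> ab bc ab' bc' s1 s2 s3.
have e2 : a * b + b * c + c * a = a' * b' + b' * c' + c' * a'.
  have E (x y z : R) : x * y + y * z + z * x =
      2^-1 * ((x + y + z) ^+ 2 - (x ^+ 2 + y ^+ 2 + z ^+ 2)) by field.
  by rewrite !E s1 s2.
have e3 : a * b * c = a' * b' * c'.
  have E (x y z : R) : x * y * z = 3^-1 * (x ^+ 3 + y ^+ 3 + z ^+ 3
      - (x + y + z) * (x ^+ 2 + y ^+ 2 + z ^+ 2 - (x * y + y * z + z * x))).
    by field.
  by rewrite !E s1 s2 s3 e2.
have root x : (x - a) * (x - b) * (x - c) = (x - a') * (x - b') * (x - c').
  have E (u v w : R) : (x - u) * (x - v) * (x - w) = x ^+ 3 - (u + v + w) * x ^+ 2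
      + (u * v + v * w + w * u) * x - u * v * w by ring.
  by rewrite !E s1 e2 e3.
have mem x : (x - a) * (x - b) * (x - c) = 0 -> [\/ x = a, x = b | x = c].
  move/eqP; rewrite !mulf_eq0 !subr_eq0 => /orP[/orP[]|] /eqP ->.
  - exact: Or31.
  - exact: Or32.
  - exact: Or33.
have mem' x : (x - a') * (x - b') * (x - c') = 0 -> [\/ x = a', x = b' | x = c'].
  move/eqP; rewrite !mulf_eq0 !subr_eq0 => /orP[/orP[]|] /eqP ->.
  - exact: Or31.
  - exact: Or32.
  - exact: Or33.
(* The largest roots bound each other, as do the smallest; the sum then settles the middle ones. *)
have c1 : c <= c'.
  by have [] := mem' c; rewrite -?root ?subrr ?mulr0 // => ->; lra.
have c2 : c' <= c.
  by have [] := mem c'; rewrite ?root ?subrr ?mulr0 // => ->; lra.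
have a1 : a <= a'.
  by have [] := mem a'; rewrite ?root ?subrr ?mul0r // => ->; lra.
have a2 : a' <= a.
  by have [] := mem' a; rewrite -?root ?subrr ?mul0r // => ->; lra.
by split; lra.
Qed.

Lemma similar_rst (r s t r' s' t' : R) (P : M) :
  admissible r s t -> admissible r' s' t' -> P \in unitmx ->
  diag_mx (ric_diag r s t) = invmx P *m diag_mx (ric_diag r' s' t') *m P ->
  (r, s, t) = (r', s', t').
Proof.
move=> [r0 rs st n1] [r0' rs' st' n1'] Pu.
set A := diag_mx _; set B := diag_mx _ => AB.
have trconj (C : M) : \tr (invmx P *m C *m P) = \tr C.
  by rewrite mxtrace_mulC mulmxA mulmxV // mul1mx.
have A2 : A *m A = invmx P *m (B *m B) *m P.
  by rewrite AB !mulmxA mulmxK.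
have A3 : A *m A *m A = invmx P *m (B *m B *m B) *m P.
  by rewrite A2 AB !mulmxA mulmxK.
have := congr1 mxtrace A3; have := congr1 mxtrace A2; rewrite !trconj.
rewrite /A /B !mulmx_diag !mxtrace_diag !sum8 !mxE /= n1 n1' => t2 t3.
(* The eigenvalues -1/2 and 0 contribute equally on both sides. What remains are the power sums of
   the squares of the parameters, degree one being the normalisation. *)
have [] : [/\ r ^+ 2 = r' ^+ 2, s ^+ 2 = s' ^+ 2 & t ^+ 2 = t' ^+ 2].
  apply: sorted_power_sums; rewrite ?ler_sqr ?nnegrE //; try lra.
have E (x y : R) : 0 <= x -> 0 <= y -> x ^+ 2 = y ^+ 2 -> x = y.
  by move=> x0 y0 /eqP; rewrite eqrXn2 // => /eqP.
by move=> /E-> // /E-> //; [move=> /E-> //|..]; lra.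
Qed.

(** The isomorphism need not be isometric, so the standard metric is pulled back to a compatible
    metric [G]. Its Ricci operator is conjugate to that of (r, s, t) through the isomorphism, and to
    c^2 times that of (r', s', t') by [ricci_compatible]. Equal traces give c^2 = 1. *)
Lemma hypercomplex_isomorphic_rst (r s t r' s' t' : R) :
  admissible r s t -> admissible r' s' t' ->
  hypercomplex_isomorphic (mu_rst r s t : V -> V -> V) J1 J2 J3
                          (mu_rst r' s' t') J1 J2 J3 ->
  (r, s, t) = (r', s', t').
Proof.
move=> adm adm' [phi [[[psi psiK phiK] phiM] [p1 p2 p3]]].
pose F := mx_of phi.
have FE x : F *m x = phi x by apply: mx_ofE => a u v; rewrite linearP.
have Fu : F \in unitmx.
  rewrite -unitmx_tr -row_free_unit -kermx_eq0; apply/rowV0P => v.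
  rewrite sub_kermx => /eqP vF.
  have : phi v^T = phi 0 by rewrite linear0 -FE -[F]trmxK -trmx_mul vF trmx0.
  by move/(can_inj psiK)/(congr1 trmx); rewrite trmxK trmx0.
have [L _] := mu_rst_lie_two_step r s t.
have [L' _] := mu_rst_lie_two_step r' s' t'.
have I1 := inner_product1 R 7.
pose G := F^T *m 1%:M *m F.
have Gi : inner_product G by exact: inner_product_pull.
have ipE (x y : V) : ip 1%:M (F *m x) (F *m y) = ip G x y by exact: ip_mulmx.
have [_ [h1 h2 h3]] := std_compatible R.
have cG : compatible_metric J1 J2 J3 G.
  split=> //; split=> x y; rewrite -!ipE !FE.
  - by rewrite !p1 h1.
  - by rewrite !p2 h2.
  - by rewrite !p3 h3.
have emu x y : F *m mu_rst r' s' t' x y = mu_rst r s t (F *m x) (F *m y).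
  by rewrite !FE phiM.
have := ricci_op_transport (lie_bilin L') (lie_bilin L) (inner_product_unit Gi)
  (inner_product_unit I1) Fu ipE
  (curvature_transport L' L Gi I1 Fu ipE emu).
have [P [c [Pu _ ->]]] := ricci_compatible cG; rewrite ricci_op_rst => e.
have trconj (Q C : M) : Q \in unitmx -> \tr (invmx Q *m C *m Q) = \tr C.
  by move=> Qu; rewrite mxtrace_mulC mulmxA mulmxV // mul1mx.
have := congr1 mxtrace e; rewrite !trconj // mxtraceZ !tr_ric_diag.
have [_ _ _ n1] := adm; have [_ _ _ n1'] := adm'.
rewrite n1 n1' mulrN1 => /oppr_inj c1; move: e; rewrite c1 scale1r => e.
have FPu : F *m invmx P \in unitmx by rewrite unitmx_mul Fu unitmx_inv.
apply/esym; apply: (similar_rst adm' adm FPu).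
have VE : invmx (F *m invmx P) = P *m invmx F.
  apply: (can_inj (mulKmx FPu)); rewrite (mulmxV FPu) mulmxA.
  by rewrite (mulmxKV Pu) (mulmxV Fu).
set D' := diag_mx _ in e *; set D := diag_mx _ in e *.
rewrite VE -!mulmxA.
have -> : P *m (invmx F *m (D *m (F *m invmx P)))
    = P *m (invmx F *m D *m F) *m invmx P by rewrite -!mulmxA.
by rewrite -e -!mulmxA (mulKVmx Pu) (mulmxV Pu) mulmx1.
Qed.

End RicciInvariants.

(** * Symmetry of second derivatives *)

Section Young.
Local Open Scope classical_set_scope.
Variables (R : realType) (V : normedModType R).
Implicit Types (p q u v : V).

Lemma is_derive_line (W : normedModType R) (f : V -> W) p u (s : R) df :
  is_derive (s *: u + p) u f df -> is_derive s 1 (fun t : R => f (t *: u + p)) df.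
Proof.
have E : (fun h : R => h^-1 *: (((fun t : R => f (t *: u + p)) \o shift s) (h *: 1)
      - f (s *: u + p)))
    = (fun h => h^-1 *: ((f \o shift (s *: u + p)) (h *: u) - f (s *: u + p))).
  apply/funext => h /=; congr (_ *: (f _ - _)).
  by rewrite /shift /= scalerDl [h *: 1]mulr1 addrA.
by move=> [d1 d2]; apply: DeriveDef; [rewrite /derivable E|rewrite /derive E].
Qed.

(** The mean value theorem in the direction u reduces the second difference to a difference of
    values of ['D_u f], which is expanded to first order at p. *)
Lemma second_difference (f : V -> R) p u v (e : R) :
  (forall q, derivable f q u) -> differentiable ('D_u f) p -> 0 < e ->
  exists2 d : R, 0 < d & forall h, 0 < h < d ->
    `|f (h *: u + (h *: v + p)) - f (h *: u + p) - (f (h *: v + p) - f p)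
      - h ^+ 2 * 'D_v ('D_u f) p| <= e * h ^+ 2.
Proof.
move=> df dg e0; set g := 'D_u f.
(* With 0 < c < h, h N bounds the sum of the norms of the two displacements c u and c u + h v at
   which [g] is expanded; the 1 keeps N positive. *)
pose N := `|u| + (`|u| + `|v|) + 1.
have N0 : 0 < N by rewrite ltr_wpDl // !addr_ge0.
have eN0 : 0 < e / N by rewrite divr_gt0.
have /eqaddoP/(_ _ eN0) := diff_locally dg.
rewrite -/(nbhs _ _) => /nbhs_norm0P[d /= d0 gP].
have gP' w : `|w| < d -> `|g (w + p) - g p - 'd g p w| <= e / N * `|w|.
  by move=> /gP; rewrite /= -/g opprD addrA.
exists (d / N) => [|h /andP[h0 hd]]; first by rewrite divr_gt0.
have hN : h * N < d by rewrite -ltr_pdivlMr.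
pose phi (s : R) := f (s *: u + (h *: v + p)) - f (s *: u + p).
pose dphi (s : R) := g (s *: u + (h *: v + p)) - g (s *: u + p).
have phiD (s : R) : is_derive s (1 : R) phi (dphi s).
  by apply: is_deriveB; apply: is_derive_line; exact: derivableP.
have phiC : {within `[0, h], continuous phi}.
  by apply: derivable_within_continuous => s _; exact: ex_derive.
have [c] := MVT h0 (fun s _ => phiD s) phiC.
rewrite in_itv /= subr0 => /andP[c0 ch].
rewrite {1 2}/phi scale0r !add0r => ->.
rewrite deriveE // -/g.
have -> : dphi c * h - h ^+ 2 * 'd g p v = h * (dphi c - 'd g p (h *: v)).
  have -> : 'd g p (h *: v) = h * 'd g p v by rewrite linearZ.
  by ring.
have -> : e * h ^+ 2 = h * (e * h) by ring.
rewrite normrM (gtr0_norm h0) ler_pM2l //.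
(* The difference of the first order remainders at c u + h v and at c u: the linear parts in c u
   cancel. *)
have -> : dphi c - 'd g p (h *: v) =
    (g (c *: u + h *: v + p) - g p - 'd g p (c *: u + h *: v))
    - (g (c *: u + p) - g p - 'd g p (c *: u)).
  by rewrite /dphi linearD /= addrA; ring.
have cu : `|c *: u| <= h * `|u|.
  by rewrite normrZ gtr0_norm // ler_wpM2r // ltW.
have cuv : `|c *: u + h *: v| <= h * (`|u| + `|v|).
  by rewrite (le_trans (ler_normD _ _)) // mulrDr lerD // normrZ gtr0_norm.
have hu : 0 <= h * `|u| by rewrite mulr_ge0 // ltW.
have hv : 0 <= h * `|v| by rewrite mulr_ge0 // ltW.
have hNE : h * N = h * `|u| + (h * `|u| + h * `|v|) + h by rewrite /N; ring.
have w1 : `|c *: u + h *: v| < d by rewrite (le_lt_trans cuv) //; lra.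
have w2 : `|c *: u| < d by rewrite (le_lt_trans cu) //; lra.
rewrite (le_trans (ler_normB _ _)) // (le_trans (lerD (gP' _ w1) (gP' _ w2))) //.
rewrite -mulrDr -mulrA ler_pM2l // ler_pdivrMl //.
by rewrite mulrC hNE; lra.
Qed.

(** The second difference is symmetric in u and v, so both mixed derivatives times h^2 lie within (e
    / 2) h^2 of it. *)
Lemma young (f : V -> R) p u v :
  (forall q, derivable f q u) -> (forall q, derivable f q v) ->
  differentiable ('D_u f) p -> differentiable ('D_v f) p ->
  'D_v ('D_u f) p = 'D_u ('D_v f) p.
Proof.
move=> fu fv du dv; apply/eqP; rewrite -subr_eq0 -normr_le0.
apply/ler_addgt0Pr => e e0; rewrite add0r.
have e2 : 0 < e / 2 by rewrite divr_gt0.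
have [d1 d10 D1] := second_difference v fu du e2.
have [d2 d20 D2] := second_difference u fv dv e2.
pose h := Num.min d1 d2 / 2.
have h0 : 0 < h by rewrite divr_gt0 // lt_min d10.
have hm : h < Num.min d1 d2 by rewrite ltr_pdivrMr // ltr_pMr ?lt_min ?d10 // ltr1n.
have /andP[h1 h2] : (h < d1) && (h < d2) by rewrite -lt_min.
have := D1 h; rewrite h0 h1 => /(_ isT); have := D2 h; rewrite h0 h2 => /(_ isT).
rewrite [h *: v + (h *: u + p)]addrCA; move: (f _) (f _) (f _) (f _) => a b c k.
move=> E2 E1; have hh : 0 < h ^+ 2 by rewrite exprn_gt0.
rewrite -(ler_pM2l hh) -{1}(gtr0_norm hh) -normrM.
move: ('D_v _ p) ('D_u _ p) E1 E2 => x y; rewrite !ler_norml => /andP[? ?] /andP[? ?].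
by apply/andP; split; lra.
Qed.

End Young.

(** * Product rules, smooth maps and the left invariant metric in coordinates *)

Section Derivatives.
Local Open Scope classical_set_scope.
Variables (R : realType) (n : nat).
Local Notation V := 'cV[R]_n.+1.
Local Notation M := 'M[R]_n.+1.
Implicit Types (p q u v w x y z : V).

Lemma is_derive_mxP (U : normedModType R) m k (F : U -> 'M[R]_(m, k)) t d D :
  is_derive t d F D <-> forall i j, is_derive t d (fun s => F s i j) (D i j).
Proof.
split=> [[dF <-] i j|dF].
  rewrite derive_mx // mxE; apply: derivableP.
  by have /derivable_mxP := dF; apply.
have dF' : derivable F t d by apply/derivable_mxP => i j; exact: ex_derive.
apply: DeriveDef => //; rewrite derive_mx //; apply/matrixP => i j.
by rewrite mxE derive_val.
Qed.

(** Expanding [b] in the basis reduces this to the product rule for coordinate functions. *)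
Lemma is_derive_bilin_form (b : V -> V -> R) (f g : V -> V) p w df dg :
  bilin (b : V -> V -> R^o) -> is_derive p w f df -> is_derive p w g dg ->
  is_derive p w (fun q => b (f q) (g q)) (b df (g p) + b (f p) dg).
Proof.
move=> lb /is_derive_mxP Df /is_derive_mxP Dg.
pose c i j := b (basis_vec R i) (basis_vec R j).
pose h i j : V -> R := c i j *: ((fun q => f q i 0) * (fun q => g q j 0)).
have -> : (fun q => b (f q) (g q)) = \sum_i \sum_j h i j.
  apply/funext => q; rewrite (bilin_basis lb) fct_sumE; apply: eq_bigr => i _.
  by rewrite fct_sumE; apply: eq_bigr => j _; rewrite /= [LHS]mulrC.
have Dh i j : is_derive p w (h i j)
    (c i j *: (f p i 0 *: dg j 0 + g p j 0 *: df i 0)).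
  have Dm := is_deriveM (Df i 0) (Dg j 0).
  exact: is_deriveZ.
have Dh' i := @is_derive_sum _ _ _ _ (h i) p w _ (Dh i).
apply: (@is_derive_eq _ _ _ _ _ _ _ _ (@is_derive_sum _ _ _ _ _ p w _ Dh')).
rewrite (bilin_basis lb df) (bilin_basis lb (f p)) -big_split /=.
apply: eq_bigr => i _; rewrite -big_split /=; apply: eq_bigr => j _.
by rewrite -/(c i j) /GRing.scale /=; ring.
Qed.

Lemma is_derive_bilin (b : V -> V -> V) (f g : V -> V) p w df dg :
  bilin b -> is_derive p w f df -> is_derive p w g dg ->
  is_derive p w (fun q => b (f q) (g q)) (b df (g p) + b (f p) dg).
Proof.
move=> lb Df Dg; apply/is_derive_mxP => i j; rewrite mxE ord1.
apply: (@is_derive_bilin_form (fun x y => b x y i 0)) => //.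
by split=> a x y z; rewrite ?lb.1 ?lb.2 !mxE.
Qed.

Lemma young_mx (f : V -> V) p u v :
  (forall q, derivable f q u) -> (forall q, derivable f q v) ->
  differentiable ('D_u f) p -> differentiable ('D_v f) p ->
  'D_v ('D_u f) p = 'D_u ('D_v f) p.
Proof.
move=> fu fv du dv.
pose fc i j : V -> R := fun q => f q i j.
have E w i j : (forall q, derivable f q w) ->
    (fun q => 'D_w f q i j) = 'D_w (fc i j).
  by move=> fw; apply/funext => q; rewrite (derive_mx (fw q)) mxE.
have cd w i j : (forall q, derivable f q w) -> differentiable ('D_w f) p ->
    differentiable ('D_w (fc i j)) p.
  move=> fw dw; rewrite -(E w i j fw).
  exact: (differentiable_comp dw (differentiable_coord _ i j)).
have cu w i j : (forall q, derivable f q w) -> forall q, derivable (fc i j) q w.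
  by move=> fw q; have /derivable_mxP := fw q; apply.
have D w w' i j : (forall q, derivable f q w) -> differentiable ('D_w f) p ->
    'D_w' ('D_w f) p i j = 'D_w' ('D_w (fc i j)) p.
  move=> fw dw; rewrite -(E w i j fw).
  have /(congr1 (fun N : V => N i j)) := derive_mx (diff_derivable (v := w') dw).
  by rewrite [X in _ = X -> _]mxE.
apply/matrixP => i j.
have Y : 'D_v ('D_u (fc i j)) p = 'D_u ('D_v (fc i j)) p.
  apply: young; [exact: cu|exact: cu|exact: cd|exact: cd].
exact: etrans (D u v i j fu du) (etrans Y (esym (D v u i j fv dv))).
Qed.

Lemma lin_differentiable (f : V -> V) p :
  (forall (a : R) x x', f (a *: x + x') = a *: f x + f x') -> differentiable f p.
Proof.
move=> lf; have -> : f = \sum_(k < n.+1) (fun x => x k 0 *: f (basis_vec R k)).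
  by apply/funext => x; rewrite (lin_fun_basis lf) fct_sumE.
apply: differentiable_sum => k; apply: differentiableZl.
exact: differentiable_coord.
Qed.

Lemma smooth_id : smooth (id : V -> V).
Proof.
(* Every iterated derivative of the identity is the identity itself or a constant. *)
move=> vs p; suff [|[c ->]] : (foldr (fun v (g : V -> V) => 'D_v g) id vs = id) \/
    exists c, foldr (fun v (g : V -> V) => 'D_v g) id vs = cst c.
- by move=> ->; exact: ex_diff.
- exact: differentiable_cst.
elim: vs => [|v vs [IH|[c IH]]] /=; first by left.
- by right; exists v; rewrite IH; apply/funext => q; rewrite derive_id.
- by right; exists 0; rewrite IH; apply/funext => q; rewrite derive_cst.
Qed.

(** Appending [v] to the list of directions makes it the first derivative taken. *)
Lemma smooth_derive (f : V -> V) v : smooth f -> smooth ('D_v f).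
Proof. by move=> sf vs p; have := sf (rcons vs v) p; rewrite foldr_rcons. Qed.

Lemma smooth_derivable (f : V -> V) p v : smooth f -> derivable f p v.
Proof. by move=> sf; apply: diff_derivable; exact: (sf [::] p). Qed.

Lemma smooth_is_derive (f : V -> V) p v : smooth f -> is_derive p v f ('D_v f p).
Proof. by move=> sf; apply: derivableP; exact: smooth_derivable. Qed.

Lemma smooth_young (f : V -> V) u v : smooth f -> 'D_v ('D_u f) = 'D_u ('D_v f).
Proof.
move=> sf; apply/funext => p; apply: young_mx => [q|q||].
- exact: smooth_derivable.
- exact: smooth_derivable.
- exact: (sf [:: u] p).
- exact: (sf [:: v] p).
Qed.

(** Left translation by - p is affine in coordinates, so its differential is its linear part. *)
Lemma left_invariant_metricE (mu : V -> V -> V) G p u v : bilin mu ->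
  left_invariant_metric mu G p u v
  = ip G (u - 2^-1 *: mu p u) (v - 2^-1 *: mu p v).
Proof.
move=> lb; rewrite /left_invariant_metric.
suff E w : 'd (bch_mul mu (- p)) p w = w - 2^-1 *: mu p w by rewrite !E.
pose T q := q + 2^-1 *: mu (- p) q.
have lT (a : R) x x' : T (a *: x + x') = a *: T x + T x'.
  rewrite /T lb.2; move: (mu _ _) (mu _ _) => y y'.
  by apply/matrixP => i j; rewrite !mxE; ring.
have TE : bch_mul mu (- p) = cst (- p) + T.
  by apply/funext => q; rewrite /bch_mul /T /= addrA.
have dT : differentiable T p by exact: lin_differentiable.
have dB : differentiable (bch_mul mu (- p)) p.
  by rewrite TE; exact: differentiableD (differentiable_cst _ _) dT.
have D1 := is_derive_bilin lb (is_derive_cst (- p) p w) (is_derive_id p w).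
have D2 := is_deriveD (is_derive_cst (- p) p w)
  (is_deriveD (is_derive_id p w) (is_deriveZ 2^-1 D1)).
have DT : is_derive p w (bch_mul mu (- p)) (w - 2^-1 *: mu p w).
  rewrite TE; apply: (is_derive_eq D2).
  by rewrite (bilin0l lb) !add0r (bilinNl lb) scalerN.
by rewrite -(deriveE w dB); exact: derive_val.
Qed.

End Derivatives.

(** * Curvature is an isometry invariant *)

Section Coframes.
Local Open Scope classical_set_scope.
Variables (R : realType) (n : nat).
Local Notation V := 'cV[R]_n.+1.
Local Notation M := 'M[R]_n.+1.

Lemma ipNl (G : M) (x z : V) : ip G (- x) z = - ip G x z.
Proof. by rewrite -scaleN1r ipZl mulN1r. Qed.

(** * Connection and curvature read in a coframe *)

Section OneCoframe.
(** [F u q] is the value at q of a one-form with values in the Lie algebra on the constant field u;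
    [F1] and [F2] are its directional derivatives. [struct] is the Maurer-Cartan equation, and [F2s]
    the symmetry of second derivatives. *)
Variables (mu : V -> V -> V) (G : M).
Hypotheses (L : is_lie_bracket mu) (Gi : inner_product G).
Variables (F : V -> V -> V) (F1 : V -> V -> V -> V) (F2 : V -> V -> V -> V -> V).
Hypotheses (dF : forall u v p, is_derive p v (F u) (F1 v u p))
  (dF1 : forall u v w p, is_derive p w (F1 v u) (F2 w v u p))
  (F2s : forall u v w p, F2 w v u p = F2 v w u p)
  (struct : forall u v p, F1 v u p - F1 u v p = mu (F u p) (F v p)).
Implicit Types p u v w z : V.
Local Notation nab := (nabla mu G).

(* The Levi-Civita derivative along v of the constant field u, read in the
   coframe F. *)
Definition cov v u p : V := F1 v u p + nab (F v p) (F u p).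

(** Constant fields commute, so this is vanishing torsion: the structure equation cancels the
    bracket in [nabla_torsion]. *)
Lemma cov_sym u v p : cov v u p = cov u v p.
Proof.
apply/eqP; rewrite -subr_eq0 /cov opprD addrACA struct (nabla_torsion _ _ L Gi).
by rewrite (lie_anti L) addNr.
Qed.

Lemma derive_gram u v z p :
  'D_v (fun q => ip G (F u q) (F z q)) p
  = ip G (cov v u p) (F z p) + ip G (F u p) (cov v z p).
Proof.
have D := is_derive_bilin_form (ip_bilin G) (dF u v p) (dF z v p).
rewrite (@derive_val _ _ _ _ _ _ _ D) /cov (ipDl G (F1 _ _ _)) (ipDr G (F1 _ _ _)).
by rewrite (nabla_skew _ _ _ L Gi); ring.
Qed.

(** The Koszul formula for commuting fields. Its right side involves only the Gram functions of the
    coframe, which an isometry preserves. *)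
Lemma cov_koszul u v z p :
  2 * ip G (cov v u p) (F z p) =
  'D_v (fun q => ip G (F u q) (F z q)) p + 'D_u (fun q => ip G (F v q) (F z q)) p
  - 'D_z (fun q => ip G (F u q) (F v q)) p.
Proof.
have [Gs _] := Gi; rewrite !derive_gram (cov_sym v u) (cov_sym z u) (cov_sym z v).
by rewrite (ip_sym (cov z u p) _ Gs); ring.
Qed.

(** Differentiating the pairing of [cov] with [F z] brings in the second derivatives [F2], which
    cancel by symmetry, while the structure equation produces the bracket term of the curvature. *)
Lemma curvature_coframe u v w z p :
  ip G (curvature mu G (F w p) (F v p) (F u p)) (F z p) =
  'D_w (fun q => ip G (cov v u q) (F z q)) p
  - 'D_v (fun q => ip G (cov w u q) (F z q)) p
  - ip G (cov v u p) (cov w z p) + ip G (cov w u p) (cov v z p).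
Proof.
have lb := lie_bilin L; have ln := nabla_bilin G lb.
(* The derivative of [F z] is completed to [cov a z], and the correcting [nabla] term is moved to
   the left factor by skewness. *)
have D a b : 'D_a (fun q => ip G (cov b u q) (F z q)) p =
    ip G (F2 a b u p + (nab (F1 a b p) (F u p) + nab (F b p) (F1 a u p))) (F z p)
    + ip G (cov b u p) (cov a z p)
    + ip G (nab (F a p) (F1 b u p) + nab (F a p) (nab (F b p) (F u p))) (F z p).
  have Dc : is_derive p a (cov b u)
      (F2 a b u p + (nab (F1 a b p) (F u p) + nab (F b p) (F1 a u p))).
    exact: is_deriveD (dF1 u b a p) (is_derive_bilin ln (dF b a p) (dF u a p)).
  have Dg := is_derive_bilin_form (ip_bilin G) Dc (dF z a p).
  have -> : nab (F a p) (F1 b u p) + nab (F a p) (nab (F b p) (F u p))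
      = nab (F a p) (cov b u p) by rewrite -(bilinDr ln).
  have -> : ip G (cov b u p) (cov a z p)
      = ip G (cov b u p) (F1 a z p) + ip G (cov b u p) (nab (F a p) (F z p)).
    by rewrite -ipDr.
  rewrite (nabla_skew _ _ _ L Gi) addrA addrK.
  exact: (@derive_val _ _ _ _ _ _ _ Dg).
have st : mu (F w p) (F v p) = F1 v w p - F1 w v p by rewrite struct.
rewrite !D /curvature st (bilinBl ln) (F2s u v w).
rewrite !(ipDl, ipNl).
by repeat match goal with |- context [ip G ?x ?y] =>
  generalize (ip G x y); intro end; ring.
Qed.

End OneCoframe.

(** Two coframes with the same Gram functions have the same pairings of [cov] with [F], by
    [cov_koszul], hence the same curvature pairings. At p, where one coframe is the identity and the
    other is [B], these become statements about the two algebras. *)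
Lemma curvature_isometry (mu mu' : V -> V -> V) (G G' B : M)
    (F F' : V -> V -> V) (F1 F1' : V -> V -> V -> V) (F2 F2' : V -> V -> V -> V -> V) p :
  is_lie_bracket mu -> inner_product G ->
  (forall u v q, is_derive q v (F u) (F1 v u q)) ->
  (forall u v w q, is_derive q w (F1 v u) (F2 w v u q)) ->
  (forall u v w q, F2 w v u q = F2 v w u q) ->
  (forall u v q, F1 v u q - F1 u v q = mu (F u q) (F v q)) ->
  is_lie_bracket mu' -> inner_product G' ->
  (forall u v q, is_derive q v (F' u) (F1' v u q)) ->
  (forall u v w q, is_derive q w (F1' v u) (F2' w v u q)) ->
  (forall u v w q, F2' w v u q = F2' v w u q) ->
  (forall u v q, F1' v u q - F1' u v q = mu' (F' u q) (F' v q)) ->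
  (forall u v q, ip G' (F' u q) (F' v q) = ip G (F u q) (F v q)) ->
  B \in unitmx -> (forall u, F u p = u) -> (forall u, F' u p = B *m u) ->
  forall x y z,
    B *m curvature mu G x y z = curvature mu' G' (B *m x) (B *m y) (B *m z).
Proof.
move=> L Gi dF dF1 F2s st L' Gi' dF' dF1' F2s' st' gram Bu FE FE'.
set C := cov mu G F F1; set C' := cov mu' G' F' F1'.
have gramE u v : (fun q => ip G' (F' u q) (F' v q)) = (fun q => ip G (F u q) (F v q)).
  by apply/funext => q.
have ipB x y : ip G' (B *m x) (B *m y) = ip G x y by rewrite -!FE' gram !FE.
have CE v u z q : ip G' (C' v u q) (F' z q) = ip G (C v u q) (F z q).
  have two0 : (2 : R) != 0 by rewrite pnatr_eq0.
  apply: (mulfI two0); rewrite (cov_koszul L' Gi' dF' st') !gramE.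
  by rewrite (cov_koszul L Gi dF st).
have CEf v u z : (fun q => ip G' (C' v u q) (F' z q)) = (fun q => ip G (C v u q) (F z q)).
  by apply/funext => q.
(* Needed for the products of two covariant derivatives in [curvature_coframe], which are evaluated
   at p only. *)
have CB v u : C' v u p = B *m C v u p.
  apply: (ip_nondeg Gi') => z; have := CE v u (invmx B *m z) p.
  rewrite FE' FE (mulKVmx Bu) => ->.
  by rewrite -[z in RHS](mulKVmx Bu) ipB.
move=> x y z; apply: (ip_nondeg Gi') => w.
rewrite -[w](mulKVmx Bu); move: (invmx B *m w) => {}w; rewrite ipB.
have := curvature_coframe L' Gi' dF' dF1' F2s' st' z y x w p.
rewrite -/C' (CEf y z w) (CEf x z w) (CB y z) (CB x w) (CB x z) (CB y w).
rewrite !ipB (FE' x) (FE' y) (FE' z) (FE' w) => ->.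
have := curvature_coframe L Gi dF dF1 F2s st z y x w p.
by rewrite -/C !FE.
Qed.

(** * The Maurer-Cartan form pulled back by a smooth map *)

Section MaurerCartan.
Variables (mu : V -> V -> V) (f : V -> V).
Hypotheses (L : is_lie_bracket mu) (ts : two_step mu) (sf : smooth f).
Implicit Types p u v w z : V.
Let lb := lie_bilin L.

(* The pull-back by f of the left invariant Maurer-Cartan form of the group
   with product bch_mul mu, and its first two derivatives. *)
Definition mc u p : V := 'D_u f p - 2^-1 *: mu (f p) ('D_u f p).
Definition mc1 v u p : V := 'D_v ('D_u f) p
  - 2^-1 *: (mu ('D_v f p) ('D_u f p) + mu (f p) ('D_v ('D_u f) p)).
Definition mc2 w v u p : V := 'D_w ('D_v ('D_u f)) p
  - 2^-1 *: (mu ('D_w ('D_v f) p) ('D_u f p) + mu ('D_v f p) ('D_w ('D_u f) p)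
    + (mu ('D_w f p) ('D_v ('D_u f) p) + mu (f p) ('D_w ('D_v ('D_u f)) p))).

Lemma is_derive_mc u v p : is_derive p v (mc u) (mc1 v u p).
Proof.
have s1 := smooth_derive u sf.
have D := is_derive_bilin lb (smooth_is_derive p v sf) (smooth_is_derive p v s1).
exact: is_deriveB (smooth_is_derive p v s1) (is_deriveZ _ D).
Qed.

Lemma is_derive_mc1 u v w p : is_derive p w (mc1 v u) (mc2 w v u p).
Proof.
have su := smooth_derive u sf; have sv := smooth_derive v sf.
have svu := smooth_derive v su.
have D1 := is_derive_bilin lb (smooth_is_derive p w sv) (smooth_is_derive p w su).
have D2 := is_derive_bilin lb (smooth_is_derive p w sf) (smooth_is_derive p w svu).
exact: is_deriveB (smooth_is_derive p w svu) (is_deriveZ _ (is_deriveD D1 D2)).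
Qed.

Lemma mc2_sym u v w p : mc2 w v u p = mc2 v w u p.
Proof.
have swap a a' b b' x0 x1 x2 x3 x4 x5 : a = a' -> b = b' ->
    a - 2^-1 *: (mu b x0 + mu x1 x2 + (mu x3 x4 + mu x5 a))
    = a' - 2^-1 *: (mu b' x0 + mu x3 x4 + (mu x1 x2 + mu x5 a')).
  by move=> -> ->; rewrite addrACA.
apply: swap.
  by have /(congr1 (fun g : V -> V => g p)) := smooth_young v w (smooth_derive u sf).
by have /(congr1 (fun g : V -> V => g p)) := smooth_young v w sf.
Qed.

(** The terms with second derivatives cancel by Young's theorem. The two halves of the bracket of
    first derivatives add up, and iterated brackets vanish in a two-step algebra. *)
Lemma mc_struct u v p : mc1 v u p - mc1 u v p = mu (mc u p) (mc v p).
Proof.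
have ts' x y z : mu z (mu x y) = 0 by rewrite (lie_anti L) ts oppr0.
have alg a a' b c x : a = a' ->
    a - 2^-1 *: (mu b c + mu x a) - (a' - 2^-1 *: (mu c b + mu x a'))
    = mu (c - 2^-1 *: mu x c) (b - 2^-1 *: mu x b).
  move=> ->; rewrite (lie_anti L b c).
  rewrite !(bilinBl lb) !(bilinBr lb) !(bilinZl lb) !(bilinZr lb) !ts !ts'.
  move: (mu c b) (mu x a') => d e.
  by apply/matrixP => i j; rewrite !mxE; field.
by apply: alg; have /(congr1 (fun g : V -> V => g p)) := smooth_young u v sf.
Qed.

End MaurerCartan.

(** The isometry condition says that the Maurer-Cartan form of the source and the pull-back by f of
    that of the target have equal Gram functions. They are compared at 0, where the former is the
    identity. *)
Lemma isometric_ricci (mu mu' : V -> V -> V) (G G' : M) :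
  is_lie_bracket mu -> two_step mu -> inner_product G ->
  is_lie_bracket mu' -> two_step mu' -> inner_product G' ->
  isometric (left_invariant_metric mu G) (left_invariant_metric mu' G') ->
  exists2 B, B \in unitmx & ricci_op mu G = invmx B *m ricci_op mu' G' *m B.
Proof.
move=> L ts Gi L' ts' Gi' [f [h [sf _ _ _ iso]]].
have lb := lie_bilin L; have lb' := lie_bilin L'.
have gram u v q : ip G' (mc mu' f u q) (mc mu' f v q) = ip G (mc mu id u q) (mc mu id v q).
  have := iso q u v; rewrite !left_invariant_metricE //.
  by rewrite -!deriveE; [|exact: (sf [::] q)..]; rewrite /mc !derive_id.
have idE u : mc mu id u 0 = u.
  by rewrite /mc derive_id (bilin0l lb) scaler0 subr0.
(* The differential of f at 0 followed by the left translation taking f 0 back to the identity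
   element. *)
pose B := mx_of (fun u => mc mu' f u 0).
have BE u : B *m u = mc mu' f u 0.
  apply: mx_ofE => a x y; rewrite /mc.
  rewrite !deriveE; [|exact: (sf [::] 0)..].
  rewrite linearP; move: ('d f 0 x) ('d f 0 y) => d e.
  rewrite lb'.2; move: (mu' (f 0) d) (mu' (f 0) e) => b c.
  by apply/matrixP => i j; rewrite !mxE; ring.
have ipB x y : ip G' (B *m x) (B *m y) = ip G x y by rewrite !BE gram !idE.
have GE : G = B^T *m G' *m B by apply: ip_inj => x y; rewrite -ip_mulmx ipB.
have Bu : B \in unitmx.
  have := inner_product_unit Gi; rewrite GE.
  by rewrite !unitmx_mul unitmx_tr => /andP[].
exists B => //.
apply: (ricci_op_transport lb lb' (inner_product_unit Gi) (inner_product_unit Gi') Bu ipB).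
have si := @smooth_id R n.
exact: (curvature_isometry (p := 0) L Gi
  (is_derive_mc L si) (is_derive_mc1 L si) (mc2_sym mu si) (mc_struct L ts si)
  L' Gi' (is_derive_mc L' sf) (is_derive_mc1 L' sf) (mc2_sym mu' sf)
  (mc_struct L' ts' sf) gram Bu idE (fun u => esym (BE u))).
Qed.

End Coframes.

(** * The Heisenberg algebras *)

Section Isomorphisms.
Variable R : realType.
Local Notation V := 'cV[R]_8.
Local Notation ix k := (@Ordinal 8 k isT).

Lemma lie_isomorphicI (U W : lmodType R) (mu : U -> U -> U) (nu : W -> W -> W)
    (f : U -> W) (g : W -> U) :
  (forall (a : R) x y, f (a *: x + y) = a *: f x + f y) ->
  cancel f g -> cancel g f -> (forall x y, f (mu x y) = nu (f x) (f y)) ->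
  lie_isomorphic mu nu.
Proof.
move=> lf fK gK fM.
pose F : {linear U -> W} := HB.pack f (GRing.isLinear.Build _ _ _ _ f lf).
by exists F; split=> //; exists g.
Qed.

Lemma lie_isomorphic_g3 (r s t : R) : r != 0 -> s != 0 -> t != 0 ->
  lie_isomorphic (mu_rst r s t : V -> V -> V) (@g3_bracket R).
Proof.
move=> r0 s0 t0.
(* X_1, .., X_4 become 1, i, j, k, and Z_2, Z_3, Z_4 become multiples of i, j, k; Z_1 spans the
   abelian factor. *)
pose f (x : V) : g3_type R := (\row_(i < 1) x (ix 4) 0,
  ((x (ix 0) 0, x (ix 1) 0, x (ix 2) 0, x (ix 3) 0),
   (x (ix 5) 0 / r, x (ix 6) 0 / s, x (ix 7) 0 / t))).
pose g (w : g3_type R) : V := let: (z, ((a, b, c, d), (e1, e2, e3))) := w in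
  vec8 [:: a; b; c; d; z 0 0; r * e1; s * e2; t * e3].
apply: (@lie_isomorphicI _ _ _ _ f g).
- move=> a x y; congr (_, (_, _)).
  + by apply/matrixP => i j; rewrite !mxE.
  + by rewrite !mxE.
  + by rewrite !mxE; congr (_, _, _); rewrite mulrDl -mulrA.
- move=> x; rewrite /f /g /=; apply: cV8P; rewrite vec8E /= ?mxE //; field; rewrite ?r0 ?s0 ?t0 //.
- case=> z [[[[a b] c] d] [[e1 e2] e3]]; rewrite /f /g /= !vec8E /=.
  congr (_, (_, _)).
    by apply/matrixP => i j; rewrite !mxE !ord1.
  by congr (_, _, _); field.
- move=> x y; rewrite mu_rstE /f /g3_bracket /sum_bracket /= !vec8E /=.
  rewrite /abelian_bracket /qheis_bracket /=.
  congr (_, (_, _)).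
    by apply/matrixP => i j; rewrite !mxE.
  by congr (_, _, _); field.
Qed.

Lemma lie_isomorphic_g1 (t : R) : t != 0 ->
  lie_isomorphic (mu_rst 0 0 t : V -> V -> V) (@g1_bracket R).
Proof.
move=> t0.
(* The symplectic pairs are (X_1, X_4) and (X_3, X_2); the second is reversed to absorb the minus
   sign of mu(X_2, X_3). *)
pose f (x : V) : g1_type R := (\row_(i < 3) nth 0 [:: x (ix 4) 0; x (ix 5) 0; x (ix 6) 0] i,
  ([ffun i : 'I_2 => nth 0 [:: x (ix 0) 0; x (ix 2) 0] i],
   [ffun i : 'I_2 => nth 0 [:: x (ix 3) 0; x (ix 1) 0] i], x (ix 7) 0 / t)).
pose g (w : g1_type R) : V := let: (z, (p, q, e)) := w in
  vec8 [:: p 0; q 1; p 1; q 0; z 0 0; z 0 1; z 0 (inord 2); t * e].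
apply: (@lie_isomorphicI _ _ _ _ f g).
- move=> a x y; congr (_, (_, _, _)).
  + by apply/matrixP => i [[|[|[|j]]] h] //; rewrite !mxE /= ?mxE.
  + by apply/ffunP => -[[|[|j]] h] //; rewrite !ffunE /= !mxE.
  + by apply/ffunP => -[[|[|j]] h] //; rewrite !ffunE /= !mxE.
  + by rewrite !mxE mulrDl -mulrA.
- move=> x; rewrite /f /g /=; apply: cV8P; rewrite vec8E /= ?ffunE ?mxE //= ?inordK //.
  by field.
- case=> z [[p q] e]; rewrite /f /g /= !vec8E /=.
  congr (_, (_, _, _)).
  + apply/matrixP => i j; rewrite mxE ord1; move: j => [[|[|[|]]] h] //=; congr (z _ _);
      by apply: val_inj; rewrite /= ?inordK.
  + by apply/ffunP => -[[|[|k]] h] //; rewrite !ffunE /=; congr (p _); apply: val_inj.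
  + by apply/ffunP => -[[|[|k]] h] //; rewrite !ffunE /=; congr (q _); apply: val_inj.
  + by field.
- move=> x y; rewrite mu_rstE /f /g1_bracket /sum_bracket /= !vec8E /=.
  rewrite /abelian_bracket /heis_bracket /=.
  congr (_, (_, _, _)).
  + by apply/matrixP => i [[|[|[|j]]] h] //; rewrite !mxE //= ?mul0r.
  + by apply/ffunP => -[[|[|j]] h] //; rewrite !ffunE.
  + by apply/ffunP => -[[|[|j]] h] //; rewrite !ffunE.
  + by rewrite !big_ord_recl big_ord0 !ffunE /=; field.
Qed.

Lemma lie_isomorphic_g2 (s t : R) : s != 0 -> t != 0 ->
  lie_isomorphic (mu_rst 0 s t : V -> V -> V) (@g2_bracket R).
Proof.
move=> s0 t0.
pose cx (a b : R) : Rcomplex R := Complex a b.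
(* With p = x_1 - i x_2 and q = x_3 + i x_4, the real and imaginary parts of p q' - p' q are the
   forms multiplying s Z_3 and t Z_4. *)
pose f (x : V) : g2_type R := (\row_(i < 2) nth 0 [:: x (ix 4) 0; x (ix 5) 0] i,
  ([ffun i : 'I_1 => cx (x (ix 0) 0) (- x (ix 1) 0)],
   [ffun i : 'I_1 => cx (x (ix 2) 0) (x (ix 3) 0)],
   cx (x (ix 6) 0 / s) (x (ix 7) 0 / t))).
pose g (w : g2_type R) : V := let: (z, (p, q, e)) := w in
  vec8 [:: complex.Re (p 0); - complex.Im (p 0); complex.Re (q 0); complex.Im (q 0);
    z 0 0; z 0 1; s * complex.Re e; t * complex.Im e].
apply: (@lie_isomorphicI _ _ _ _ f g).
- move=> a x y; congr (_, (_, _, _)).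
  + by apply/matrixP => i [[|[|j]] h] //; rewrite !mxE /= ?mxE.
  + by apply/ffunP => i; rewrite !ffunE !mxE /cx; congr Complex; ring.
  + by apply/ffunP => i; rewrite !ffunE !mxE /cx; congr Complex; ring.
  + by rewrite !mxE /cx; congr Complex; ring.
- move=> x; rewrite /f /g /=; apply: cV8P; rewrite vec8E /= ?ffunE ?mxE //= ?opprK //.
    by field.
  by field.
- case=> z [[p q] [e1 e2]]; rewrite /f /g /= !vec8E /=.
  congr (_, (_, _, _)).
  + apply/matrixP => i j; rewrite mxE ord1; move: j => [[|[|]] h] //=; congr (z _ _);
      by apply: val_inj.
  + by apply/ffunP => i; rewrite !ffunE /= opprK ord1; case: (p 0).
  + by apply/ffunP => i; rewrite !ffunE /= ord1; case: (q 0).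
  + by rewrite /cx; congr Complex; field.
- move=> x y; rewrite mu_rstE /f /g2_bracket /sum_bracket /= !vec8E /=.
  rewrite /abelian_bracket /heis_bracket /=.
  congr (_, (_, _, _)).
  + by apply/matrixP => i [[|[|j]] h] //; rewrite !mxE //= ?mul0r.
  + by apply/ffunP => i; rewrite !ffunE /cx oppr0.
  + rewrite big_ord_recl big_ord0 addr0 !ffunE.
    transitivity (cx
      (x (ix 0) 0 * y (ix 2) 0 - (- x (ix 1) 0) * y (ix 3) 0
       - (y (ix 0) 0 * x (ix 2) 0 - (- y (ix 1) 0) * x (ix 3) 0))
      (x (ix 0) 0 * y (ix 3) 0 + (- x (ix 1) 0) * y (ix 2) 0
       - (y (ix 0) 0 * x (ix 3) 0 + (- y (ix 1) 0) * x (ix 2) 0))) => //.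
    by congr cx; field.
Qed.

End Isomorphisms.

Theorem mainTheorem4 (R : realType) :
  (* (i) *)
  (forall r s t : R, admissible r s t ->
     abelian_hypercomplex (mu_rst r s t) J1 J2 J3 /\
     minimal_metric (mu_rst r s t) J1 J2 J3 std_ip) /\
  (* (ii) *)
  (forall r s t r' s' t' : R, admissible r s t -> admissible r' s' t' ->
     (r, s, t) <> (r', s', t') ->
     ~ isometric (metric_rst r s t) (metric_rst r' s' t') /\
     ~ hypercomplex_isomorphic (mu_rst r s t) J1 J2 J3
                               (mu_rst r' s' t') J1 J2 J3) /\
  (* (iii) *)
  (forall r s t : R, admissible r s t ->
     [/\ 0 < r -> lie_isomorphic (mu_rst r s t) (@g3_bracket R),
         r = 0 -> 0 < s -> lie_isomorphic (mu_rst r s t) (@g2_bracket R)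
       & r = 0 -> s = 0 -> t = 1 ->
         lie_isomorphic (mu_rst r s t) (@g1_bracket R)]).
Proof.
split; [|split].
- move=> r s t [_ _ _ rst1]; split; first exact: abelian_hypercomplex_rst.
  exact: minimal_rst.
- move=> r s t r' s' t' adm adm' neq; split.
    have [L ts] := mu_rst_lie_two_step r s t.
    have [L' ts'] := mu_rst_lie_two_step r' s' t'.
    have I1 := inner_product1 R 7.
    move=> /(isometric_ricci L ts I1 L' ts' I1)[B Bu]; rewrite !ricci_op_rst.
    by move/(similar_rst adm adm' Bu).
  by move/(hypercomplex_isomorphic_rst adm adm').
- move=> r s t [_ rs st _]; split.
  + move=> r0; have s0 := lt_le_trans r0 rs; have t0 := lt_le_trans s0 st.
    by apply: lie_isomorphic_g3; rewrite gt_eqF.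
  + move=> -> s0; have t0 := lt_le_trans s0 st.
    by apply: lie_isomorphic_g2; rewrite gt_eqF.
  + by move=> -> -> ->; apply: lie_isomorphic_g1; rewrite oner_eq0.
Qed.
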